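(* Let $m\in\mathbb N_0\cup\{\infty\}$, let $(\tilde\nu_n)_{n=0}^m$ be positive regular Borel measures on $[0,\infty)$ each satisfying the $\Delta_2$-condition, let $A^2_{(m)}$ be the associated reproducing kernel Hilbert space of analytic functions on $\mathbb C_+$ with reproducing kernels $k_z^{A^2_{(m)}}$, and let $\mu$ be a positive Borel measure on $\mathbb C_+$. If $$\sup_{z\in\mathbb C_+}\int_{\mathbb C_+}\left|k_z^{A^2_{(m)}}(\zeta)\right|\,d\mu(\zeta)<\infty,$$ then $\mu$ is a Carleson measure for $A^2_{(m)}$.
   Context: $\mathbb C_+=\{z\in\mathbb C:\operatorname{Re}z>0\}$. A nonzero, locally finite positive regular Borel measure $\tilde\nu$ on $[0,\infty)$ satisfies the $\Delta_2$-condition if $\sup_{r>0}\tilde\nu[0,2r)/\tilde\nu[0,r)<\infty$. For $t>0$ put $$w_n(t)=2\pi t^{2n}\int_0^\infty e^{-2rt}\,d\tilde\nu_n(r),\qquad w_{(m)}(t)=\sum_{n=0}^m w_n(t).$$ $L^2_{w_{(m)}}(0,\infty)$ is the Hilbert space of $f:(0,\infty)\to\mathbb C$ with $\|f\|^2=\int_0^\infty|f(t)|^2w_{(m)}(t)\,dt<\infty$, and $\mathfrak L$ is the Laplace transform, $\mathfrak L[f](z)=\int_0^\infty f(t)e^{-tz}\,dt$. The space $A^2_{(m)}=\mathfrak L(L^2_{w_{(m)}}(0,\infty))$ carries the norm $\|\mathfrak L[f]\|_{A^2_{(m)}}=\|f\|_{L^2_{w_{(m)}}(0,\infty)}$; it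 is a reproducing kernel Hilbert space of analytic functions on $\mathbb C_+$ with kernel $$k_z^{A^2_{(m)}}(\zeta)=\int_0^\infty\frac{e^{-t(\overline z+\zeta)}}{w_{(m)}(t)}\,dt\qquad(z,\zeta\in\mathbb C_+)$$ (with the convention $1/\infty=0$). A positive Borel measure $\mu$ on $\mathbb C_+$ is a Carleson measure for a Hilbert space $\mathcal H$ of functions on $\mathbb C_+$ if there is a constant $C(\mu)>0$ with $\int_{\mathbb C_+}|h|^2\,d\mu\le C(\mu)\|h\|_{\mathcal H}^2$ for all $h\in\mathcal H$. *)

(* Defs.v *)
From HB Require Import structures.
From mathcomp Require Import all_boot all_order all_algebra.
From mathcomp Require Import complex.
From mathcomp Require Import all_classical all_reals all_analysis.

Set Implicit Arguments.
Unset Strict Implicit.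
Unset Printing Implicit Defensive.

Import Order.TTheory GRing.Theory Num.Theory.
Import numFieldNormedType.Exports.

Local Open Scope classical_set_scope.
Local Open Scope ring_scope.

(* A Borel measure on a Borel subset X of R (or C) is
   encoded as a measure on the Borel sets of R (or C) of which only the trace
   on X is ever used: nothing below depends on the mass outside X. *)

(* The Borel sigma-algebra of the norm topology of the complex numbers. *)
Definition borelC (R : realType) := g_sigma_algebraType (@open R[i]^o).

Definition Cplus (R : realType) : set (borelC R) :=
  [set z : R[i] | 0 < complex.Re z].

Definition cmod (R : realType) (z : R[i]) : R := ComplexField.Normc.normc z.

Definition cexp (R : realType) (z : R[i]) : R[i] :=
  Complex (expR (complex.Re z) * cos (complex.Im z))
          (expR (complex.Re z) * sin (complex.Im z)).

Definition cintegral (R : realType) (D : set (measurableTypeR R))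
    (f : R -> R[i]) : R[i] :=
  Complex (\int[lebesgue_measure]_(t in D) complex.Re (f t))
          (\int[lebesgue_measure]_(t in D) complex.Im (f t)).

Section HalfLineMeasures.
Context {R : realType}.
Implicit Type nu : {measure set (measurableTypeR R) -> \bar R}.
Local Open Scope ereal_scope.

Definition locally_finite_on (X : set R) nu :=
  forall x, X x -> exists2 U : set R, open_nbhs x U & nu (U `&` X) < +oo.

(* Relatively open subsets of X are the sets U `&` X with U open. *)
Definition regular_on (X : set R) nu :=
  forall A : set (measurableTypeR R), measurable A -> A `<=` X ->
    nu A = ereal_inf [set nu (U `&` X) | U in [set U : set R | open U /\ A `<=` U]]
    /\
    nu A = ereal_sup [set nu K | K in [set K : set R | compact K /\ K `<=` A]].

(* In \bar R, x / 0 = +oo for x > 0 and 0 / 0 = 0.  The latter is harmless: if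
   nu is nonzero but vanishes on some [0, r), then for the largest such r the
   ratio is +oo. *)
Definition Delta2 nu :=
  [/\ nu `[0%R, +oo[%classic != 0,
      locally_finite_on `[0%R, +oo[ nu,
      regular_on `[0%R, +oo[ nu &
      ereal_sup [set nu `[0%R, (2 * r)%R[%classic / nu `[0%R, r[%classic |
                 r in [set r : R | (0 < r)%R]] < +oo].

End HalfLineMeasures.

(* The upper index m ranges over N u {oo}; None stands for oo. *)
Definition upto (m : option nat) (n : nat) : bool :=
  if m is Some k then (n <= k)%N else true.

Section Weights.
Context {R : realType}.
Local Open Scope ereal_scope.

Definition weight (nu : {measure set (measurableTypeR R) -> \bar R}) (n : nat)
    (t : R) : \bar R :=
  (2 * pi * t ^+ n.*2)%:E *
  \int[nu]_(r in `[0%R, +oo[) (expR (- (2 * r * t)))%:E.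

Definition weight_sum (m : option nat)
    (nu : nat -> {measure set (measurableTypeR R) -> \bar R}) (t : R) : \bar R :=
  \sum_(0 <= n <oo | upto m n) weight (nu n) n t.

End Weights.

Section LaplaceSpace.
Context {R : realType}.
Implicit Types (w : R -> \bar R) (f : R -> R[i]) (h : borelC R -> R[i]).

Definition L2norm w f : \bar R :=
  ((\int[lebesgue_measure]_(t in `]0%R, +oo[) (((cmod (f t)) ^+ 2)%:E * w t))
    `^ (2^-1)%R)%E.

(* Every Lebesgue measurable function agrees almost everywhere with a Borel
   one, so restricting to Borel representatives loses nothing. *)
Definition L2 w : set (R -> R[i]) :=
  [set f | @measurable_fun _ _ (measurableTypeR R) (borelC R) `]0, +oo[ f /\
           (L2norm w f < +oo)%E].

Definition Laplace f : borelC R -> R[i] := fun z =>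
  cintegral `]0, +oo[ (fun t => f t * cexp (- (t%:C%C * z))).

(* f represents h: a function on the half-plane is encoded by any extension to
   C, so h and the transform are only compared on the half-plane. *)
Definition Laplace_preimage w h : set (R -> R[i]) :=
  [set f | L2 w f /\ forall z, Cplus z -> h z = Laplace f z].

Definition A2 w : set (borelC R -> R[i]) :=
  [set h | Laplace_preimage w h !=set0].

(* The transported (quotient) norm.  For the weights of interest the Laplace
   transform is injective modulo equality w dt-almost everywhere, so that the
   infimum is over a single value and A2norm w (Laplace f) = L2norm w f. *)
Definition A2norm w h : \bar R :=
  ereal_inf [set L2norm w f | f in Laplace_preimage w h].

(* In \bar R, the inverse of +oo is 0. *)
Definition A2kernel w (z zeta : borelC R) : R[i] :=
  cintegral `]0, +oo[ (fun t =>
    cexp (- (t%:C%C * (conjc z + zeta))) * (fine (w t)^-1%E)%:C%C).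

(* H is a space of functions on the half-plane and N its norm. *)
Definition Carleson (H : set (borelC R -> R[i])) (N : (borelC R -> R[i]) -> \bar R)
    (mu : {measure set (borelC R) -> \bar R}) :=
  exists2 C : R, 0 < C &
    forall h, H h ->
      (\int[mu]_(z in @Cplus R) ((cmod (h z)) ^+ 2)%:E <= C%:E * N h ^+ 2)%E.

End LaplaceSpace.

(* Main.v *)
Require Import Defs.
From mathcomp Require Import all_boot all_order all_algebra.
From mathcomp Require Import complex.
From mathcomp Require Import all_classical all_reals all_analysis.
From mathcomp Require Import measurable_realfun ring lra.

Set Implicit Arguments.
Unset Strict Implicit.
Unset Printing Implicit Defensive.

Import Order.TTheory GRing.Theory Num.Theory.
Import numFieldNormedType.Exports.

Local Open Scope classical_set_scope.
Local Open Scope ring_scope.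

(** The Laplace transform f |-> L f, seen as a map from L^2(w dt) to L^2(mu),
    is an integral operator whose kernel e(z, t) = exp (- t z) has Gram function
      k_z(zeta) = int conj (e(z, t)) e(zeta, t) v(t) dt,   v = 1 / w,
    so T T^* is the integral operator with kernel k.  A Schur test applied to
    T T^* therefore bounds T: if int |k_z| dmu <= C for all z, then
    int |L f|^2 dmu <= C int |f|^2 w.  The absolute value is taken after the
    integration in t, hence the cancellation in k_z is kept.

    To argue on functions rather than on operators, g = L f
    is tested against itself ([transform_sqr_le]).  With
    H(t) = int conj (g(z)) e(z, t) dmu(z), Fubini gives int |g|^2 = int f H dt,
    the arithmetic-geometric mean inequality gives
      2 int |g|^2 <= C int |f|^2 w + C^-1 int |H|^2 v,
    and two more uses of Fubini turn int |H|^2 v into the double integral of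
    conj (g(zeta)) g(z) k_z(zeta), which the Schur test ([schur_test]) bounds by
    C int |g|^2.  Absorbing this term on the left gives the result, provided that
    int |g|^2 is finite.

    Finiteness and Fubini hold when mu has finite mass and lives in a half-plane
    Re z >= delta > 0, where g is bounded ([Laplace_sqr_le]).  The whole
    half-plane is exhausted by such pieces ([sigma_finite_Cplus]): the sets on
    which |k_z| >= 1 / (n + 1) have finite mass, and countably many of them cover
    it, because k_z(zeta) is nonzero as soon as Im z is close to Im zeta
    ([kernel_neq0]).  The only exception is v = 0 almost everywhere, that is
    w = +oo almost everywhere, and then the space is {0}
    ([null_inverse_Laplace]).

    The argument works for every measurable positive weight w such that
    exp (- s t) / w(t) is integrable for all s > 0 ([carleson_of_kernel]).  For the
    weights of the theorem this comes from the term n = 0: the doubling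
    condition forces nu_0 [0, r) > 0 for every r > 0, whence
    w(t) >= 2 pi exp (- 2 r t) nu_0 [0, r) with r as small as desired
    ([weight_sum_lower]). *)

(** * Complex-valued functions and their integrals *)
Section Modulus.
Context {R : realType}.
Implicit Types z u : R[i].

Lemma cmod_ge0 z : 0 <= cmod z.
Proof. by case: z => a b; exact: sqrtr_ge0. Qed.

Lemma cmodM z u : cmod (z * u) = cmod z * cmod u.
Proof. exact: ComplexField.Normc.normcM. Qed.

Lemma cmod_sqr z : cmod z ^+ 2 = complex.Re z ^+ 2 + complex.Im z ^+ 2.
Proof. by case: z => a b; rewrite /cmod /= sqr_sqrtr ?addr_ge0 ?sqr_ge0. Qed.

Lemma cmodJ z : cmod (conjc z) = cmod z.
Proof. by case: z => a b; rewrite /cmod /= sqrrN. Qed.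

Lemma cmod_real (a : R) : 0 <= a -> cmod a%:C%C = a.
Proof. by move=> a0; rewrite /cmod /= expr0n addr0 sqrtr_sqr ger0_norm. Qed.

Lemma cmod0 : cmod (0 : R[i]) = 0.
Proof. exact: cmod_real. Qed.

Lemma normr_Re_le z : `|complex.Re z| <= cmod z.
Proof.
by rewrite -ler_sqr ?nnegrE ?cmod_ge0 // cmod_sqr real_normK ?num_real // lerDl sqr_ge0.
Qed.

Lemma normr_Im_le z : `|complex.Im z| <= cmod z.
Proof.
by rewrite -ler_sqr ?nnegrE ?cmod_ge0 // cmod_sqr real_normK ?num_real // lerDr sqr_ge0.
Qed.

Lemma Re_le_cmod z : complex.Re z <= cmod z.
Proof. exact: le_trans (ler_norm _) (normr_Re_le _). Qed.

Lemma conjcM z u : conjc (z * u) = conjc z * conjc u.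
Proof. exact: (rmorphM (@conjc R)). Qed.

Lemma cReM z u : complex.Re (z * u) =
  complex.Re z * complex.Re u - complex.Im z * complex.Im u.
Proof. by case: z u => a b [c d]. Qed.

Lemma cImM z u : complex.Im (z * u) =
  complex.Re z * complex.Im u + complex.Im z * complex.Re u.
Proof. by case: z u => a b [c d]. Qed.

Lemma cReJ z : complex.Re (conjc z) = complex.Re z.
Proof. by case: z. Qed.

Lemma cImJ z : complex.Im (conjc z) = - complex.Im z.
Proof. by case: z. Qed.

Lemma Re_conjM z : complex.Re (conjc z * z) = cmod z ^+ 2.
Proof. by rewrite cmod_sqr cReM cReJ cImJ mulNr opprK -!expr2. Qed.

Lemma complex_ext z u :
  complex.Re z = complex.Re u -> complex.Im z = complex.Im u -> z = u.
Proof. by case: z u => a b [c d] /= -> ->. Qed.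

End Modulus.

Section ComplexMeasurable.
Context d (T : measurableType d) {R : realType}.
Implicit Types f g : T -> R[i].

(** Componentwise, because all integrals below are taken componentwise; for
    functions into the Borel complex plane it follows from measurability. *)
Definition cmeasurable f :=
  measurable_fun setT (fun x => complex.Re (f x)) /\
  measurable_fun setT (fun x => complex.Im (f x)).

Lemma cmeasurable_real (a : T -> R) : measurable_fun setT a ->
  cmeasurable (fun x => (a x)%:C%C).
Proof. by move=> ma; split => //=; exact: measurable_cst. Qed.

Lemma cmeasurable_conj f : cmeasurable f -> cmeasurable (fun x => conjc (f x)).
Proof.
case=> mr mi; split; first by under eq_fun do rewrite cReJ.
by under eq_fun do rewrite cImJ; exact: measurable_funN.
Qed.

Lemma cmeasurableM f g : cmeasurable f -> cmeasurable g ->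
  cmeasurable (fun x => f x * g x).
Proof.
move=> [fr fi] [gr gi]; split.
  under eq_fun do rewrite cReM.
  by apply: measurable_funB; exact: measurable_funM.
under eq_fun do rewrite cImM.
by apply: measurable_funD; exact: measurable_funM.
Qed.

Lemma cmeasurable_cst (c : R[i]) : cmeasurable (fun=> c).
Proof. by split; exact: measurable_cst. Qed.

Lemma measurable_cmod f : cmeasurable f -> measurable_fun setT (fun x => cmod (f x)).
Proof.
move=> [fr fi].
rewrite (_ : (fun x => _) =
  fun x => Num.sqrt (complex.Re (f x) ^+ 2 + complex.Im (f x) ^+ 2)); last first.
  by apply/funext => x; case: (f x).
apply: (measurableT_comp (continuous_measurable_fun _)).
  by move=> x; exact: sqrt_continuous.
by apply: measurable_funD; exact: measurable_funX.
Qed.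

End ComplexMeasurable.

Lemma cmeasurable_comp d1 d2 (T1 : measurableType d1) (T2 : measurableType d2)
    (R : realType) (f : T2 -> R[i]) (h : T1 -> T2) :
  cmeasurable f -> measurable_fun setT h -> cmeasurable (fun x => f (h x)).
Proof.
move=> [fr fi] mh; split.
  exact: (measurableT_comp fr mh).
exact: (measurableT_comp fi mh).
Qed.

Section ComplexIntegral.
Context d (T : measurableType d) {R : realType} (mu : {measure set T -> \bar R}).
Implicit Types f g : T -> R[i].

Definition cint f : R[i] :=
  Complex (\int[mu]_x complex.Re (f x)) (\int[mu]_x complex.Im (f x)).

Lemma cint0 : cint (fun=> 0) = 0.
Proof.
have r0 : \int[mu]_x (0 : R) = 0 by rewrite /Rintegral integral0.
by rewrite /cint /= !r0.
Qed.

Lemma eq_cint f g : f =1 g -> cint f = cint g.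
Proof. by move=> /funext ->. Qed.

Lemma Re_cint f : complex.Re (cint f) = \int[mu]_x complex.Re (f x).
Proof. by []. Qed.

Lemma dominated_integrable (h b : T -> R) : measurable_fun setT h ->
  (forall x, `|h x| <= b x) -> mu.-integrable setT (EFin \o b) ->
  mu.-integrable setT (EFin \o h).
Proof.
move=> mh hb ib; apply: le_integrable ib => //; first exact/measurable_EFinP.
move=> x _ /=; rewrite lee_fin (le_trans (hb x)) // ler_norm //.
Qed.

Section Dominated.
Variables (f : T -> R[i]) (b : T -> R).
Hypotheses (mf : cmeasurable f) (fb : forall x, cmod (f x) <= b x).
Hypothesis ib : mu.-integrable setT (EFin \o b).

Lemma integrable_Re : mu.-integrable setT (EFin \o (fun x => complex.Re (f x))).
Proof.
apply: dominated_integrable ib; first by case: mf.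
by move=> x; exact: le_trans (normr_Re_le _) (fb x).
Qed.

Lemma integrable_Im : mu.-integrable setT (EFin \o (fun x => complex.Im (f x))).
Proof.
apply: dominated_integrable ib; first by case: mf.
by move=> x; exact: le_trans (normr_Im_le _) (fb x).
Qed.

Lemma integrable_ReZ c :
  mu.-integrable setT (EFin \o (fun x => c * complex.Re (f x))).
Proof. exact: (integrableZl _ c integrable_Re). Qed.

Lemma integrable_ImZ c :
  mu.-integrable setT (EFin \o (fun x => c * complex.Im (f x))).
Proof. exact: (integrableZl _ c integrable_Im). Qed.

Lemma cintZ (c : R[i]) : cint (fun x => c * f x) = c * cint f.
Proof.
have iR := integrable_Re; have iI := integrable_Im.
apply: complex_ext; rewrite ?cReM ?cImM /cint /=.
  under eq_Rintegral do rewrite cReM.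
  rewrite RintegralB //; [|exact: integrable_ReZ|exact: integrable_ImZ].
  by rewrite !RintegralZl.
under eq_Rintegral do rewrite cImM.
rewrite RintegralD //; [|exact: integrable_ImZ|exact: integrable_ReZ].
by rewrite !RintegralZl.
Qed.

Lemma cint_conj : cint (fun x => conjc (f x)) = conjc (cint f).
Proof.
apply: complex_ext; rewrite ?cReJ ?cImJ /cint /=.
  by under eq_Rintegral do rewrite cReJ.
under eq_Rintegral do rewrite cImJ -mulN1r.
by rewrite RintegralZl ?mulN1r //; exact: integrable_Im.
Qed.

(** Multiplying the integrand by the conjugate of the integral makes the value
    of the integral real, and the real part of a complex number is at most its
    modulus. *)
Lemma cmod_cint_le : cmod (cint f) <= \int[mu]_x b x.
Proof.
have b0 : 0 <= \int[mu]_x b x.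
  by apply: Rintegral_ge0 => x _; exact: le_trans (cmod_ge0 _) (fb x).
set I := cint f.
have [I0|I0] := eqVneq (cmod I) 0; first by rewrite I0.
have Ip : 0 < cmod I by rewrite lt_neqAle eq_sym I0 cmod_ge0.
rewrite -(ler_pM2l Ip) -expr2 -Re_conjM -cintZ Re_cint -RintegralZl //.
apply: le_Rintegral => //.
- have := integrableB measurableT (integrable_ReZ (complex.Re (conjc I)))
                      (integrable_ImZ (complex.Im (conjc I))).
  by apply: eq_integrable => // x _; rewrite /= cReM EFinB.
- exact: (integrableZl _ (cmod I) ib).
move=> x _; rewrite (le_trans (Re_le_cmod _)) // cmodM cmodJ.
by rewrite ler_wpM2l // cmod_ge0.
Qed.

End Dominated.
End ComplexIntegral.

(** * Integral operators and their transposes *)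
Section Swap.
Context dX dY (X : measurableType dX) (Y : measurableType dY) {R : realType}.
Variables (mu : {finite_measure set X -> \bar R}).
Variables (lam : {sigma_finite_measure set Y -> \bar R}).

(** The bound is uniform in x and mu is finite, so every section is integrable,
    not just almost every one; this is what allows finite-valued integrals on
    both sides. *)
Lemma Rintegral_swap (F : X * Y -> R) (b : Y -> R) : measurable_fun setT F ->
  (forall x y, `|F (x, y)| <= b y) -> lam.-integrable setT (EFin \o b) ->
  \int[mu]_x (\int[lam]_y F (x, y)) = \int[lam]_y (\int[mu]_x F (x, y)).
Proof.
move=> mF Fb ib.
have mFx x : measurable_fun setT (fun y => F (x, y)) by exact: measurableT_comp.
have mFy y : measurable_fun setT (fun x => F (x, y)) by exact: measurableT_comp.
have iFx x : lam.-integrable setT (fun y => (F (x, y))%:E).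
  exact: (dominated_integrable (mFx x) (Fb x) ib).
have iFy y : mu.-integrable setT (fun x => (F (x, y))%:E).
  apply: (dominated_integrable (mFy y) (Fb ^~ y)).
  exact: finite_measure_integrable_cst.
have iF : (mu \x lam)%E.-integrable setT (EFin \o F).
  apply/integrable12ltyP; first exact/measurable_EFinP.
  apply: (@le_lt_trans _ _ (\int[mu]_x \int[lam]_y (b y)%:E)%E).
    apply: ge0_le_integral => //.
    - by move=> x _; exact: integral_ge0.
    - apply: (measurable_fun_fubini_tonelli_F (fun z => `|(F z)%:E|%E)) => //.
      by apply: measurableT_comp => //; exact/measurable_EFinP.
    - move=> x _; apply: ge0_le_integral => //.
      + by apply: measurableT_comp => //; apply/measurable_EFinP.
      + exact: measurable_int ib.
      + by move=> y _; rewrite lee_fin.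
  rewrite integral_cst // lte_mul_pinfty //.
  - by apply: integral_ge0 => y _; rewrite lee_fin (le_trans _ (Fb point y)).
  - exact: integrable_fin_num.
  - by rewrite ltey_eq fin_num_measure.
rewrite /Rintegral; congr fine.
under eq_integral do rewrite fineK ?integrable_fin_num //.
under [RHS]eq_integral do rewrite fineK ?integrable_fin_num //.
exact: (Fubini iF).
Qed.

End Swap.

Section TransformPair.
Context dX dY (X : measurableType dX) (Y : measurableType dY) {R : realType}.
Variables (mu : {finite_measure set X -> \bar R}).
Variables (lam : {sigma_finite_measure set Y -> \bar R}).
Variables (e : X * Y -> R[i]) (b : Y -> R).
Hypotheses (me : cmeasurable e) (eb : forall x y, cmod (e (x, y)) <= b y).
Hypothesis mb : measurable_fun setT b.

(** The operator T with kernel e.  The transpose below, applied to conj g, is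
    the conjugate of T^* g in the unweighted L^2(lam). *)
Definition transform (f : Y -> R[i]) (x : X) : R[i] :=
  cint lam (fun y => f y * e (x, y)).

Definition cotransform (g : X -> R[i]) (y : Y) : R[i] :=
  cint mu (fun x => g x * e (x, y)).

Lemma bound_ge0 y : 0 <= b y.
Proof. exact: le_trans (cmod_ge0 _) (eb point y). Qed.

Lemma cmeasurable_secY x : cmeasurable (fun y => e (x, y)).
Proof. exact: cmeasurable_comp. Qed.

Lemma cmeasurable_secX y : cmeasurable (fun x => e (x, y)).
Proof. exact: cmeasurable_comp. Qed.

(** The integral is by definition a difference of two integrals of nonnegative
    functions, each of which is measurable by Tonelli. *)
Lemma measurable_Rintegral_snd (F : X * Y -> R) : measurable_fun setT F ->
  measurable_fun setT (fun x => \int[lam]_y F (x, y)).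
Proof.
move=> mF; apply: measurableT_comp; first exact: fine_measurable.
have mEF : measurable_fun setT (EFin \o F) by exact/measurable_EFinP.
rewrite (_ : (fun x => _) = (fubini_F lam (EFin \o F)^\+%E \- fubini_F lam (EFin \o F)^\-%E)%E).
  apply: emeasurable_funB.
    by apply: measurable_fun_fubini_tonelli_F => //; exact: measurable_funepos.
  by apply: measurable_fun_fubini_tonelli_F => //; exact: measurable_funeneg.
apply/funext => x; rewrite integralE /fubini_F; congr (_ - _)%E.
  by apply: eq_integral => y _; rewrite !funeposE.
by apply: eq_integral => y _; rewrite !funenegE.
Qed.

Lemma measurable_Rintegral_fst (F : X * Y -> R) : measurable_fun setT F ->
  measurable_fun setT (fun y => \int[mu]_x F (x, y)).
Proof.
move=> mF; apply: measurableT_comp; first exact: fine_measurable.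
have mEF : measurable_fun setT (EFin \o F) by exact/measurable_EFinP.
rewrite (_ : (fun y => _) = (fubini_G mu (EFin \o F)^\+%E \- fubini_G mu (EFin \o F)^\-%E)%E).
  apply: emeasurable_funB.
    by apply: measurable_fun_fubini_tonelli_G => //; exact: measurable_funepos.
  by apply: measurable_fun_fubini_tonelli_G => //; exact: measurable_funeneg.
apply/funext => y; rewrite integralE /fubini_G; congr (_ - _)%E.
  by apply: eq_integral => x _; rewrite !funeposE.
by apply: eq_integral => x _; rewrite !funenegE.
Qed.

Lemma cmeasurable_transform f : cmeasurable f -> cmeasurable (transform f).
Proof.
move=> mf.
have mfe : cmeasurable (fun z : X * Y => f z.2 * e z).
  by apply: cmeasurableM => //; exact: cmeasurable_comp.
by case: mfe => mr mi; split; exact: (@measurable_Rintegral_snd (fun z => _ (f z.2 * e z))).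
Qed.

Lemma cmeasurable_cotransform g : cmeasurable g -> cmeasurable (cotransform g).
Proof.
move=> mg.
have mge : cmeasurable (fun z : X * Y => g z.1 * e z).
  by apply: cmeasurableM => //; exact: cmeasurable_comp.
by case: mge => mr mi; split; exact: (@measurable_Rintegral_fst (fun z => _ (g z.1 * e z))).
Qed.

Lemma cmod_transform_le f x : cmeasurable f ->
  lam.-integrable setT (EFin \o (fun y => cmod (f y) * b y)) ->
  cmod (transform f x) <= \int[lam]_y (cmod (f y) * b y).
Proof.
move=> mf ifb; apply: cmod_cint_le ifb.
  by apply: cmeasurableM => //; exact: cmeasurable_secY.
by move=> y; rewrite cmodM ler_wpM2l ?cmod_ge0.
Qed.

Lemma cmod_cotransform_le g M y : cmeasurable g -> (forall x, cmod (g x) <= M) ->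
  cmod (cotransform g y) <= M * fine (mu setT) * b y.
Proof.
move=> mg gM.
have ->: M * fine (mu setT) * b y = \int[mu]_x (cst (M * b y) x).
  by rewrite Rintegral_cst // mulrAC.
apply: (@cmod_cint_le _ _ _ _ _ (cst (M * b y))).
- by apply: cmeasurableM => //; exact: cmeasurable_secX.
- by move=> x; rewrite cmodM ler_pM ?cmod_ge0.
- exact: finite_measure_integrable_cst.
Qed.

Lemma transform_swap (f : Y -> R[i]) (g : X -> R[i]) (M : R) :
  cmeasurable f -> cmeasurable g -> (forall x, cmod (g x) <= M) ->
  lam.-integrable setT (EFin \o (fun y => cmod (f y) * b y)) ->
  cint mu (fun x => g x * transform f x) = cint lam (fun y => f y * cotransform g y).
Proof.
move=> mf mg gM ifb.
pose F z : R[i] := g z.1 * (f z.2 * e z).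
have mfe : cmeasurable (fun z : X * Y => f z.2 * e z).
  by apply: cmeasurableM => //; exact: cmeasurable_comp.
have mF : cmeasurable F by apply: cmeasurableM => //; exact: cmeasurable_comp.
have feb x y : cmod (f y * e (x, y)) <= cmod (f y) * b y.
  by rewrite cmodM ler_wpM2l ?cmod_ge0.
have Fb x y : cmod (F (x, y)) <= M * (cmod (f y) * b y).
  by rewrite cmodM ler_pM ?cmod_ge0 ?feb.
have gs x : g x * transform f x = cint lam (fun y => F (x, y)).
  rewrite -(@cintZ _ _ _ lam _ (fun y => cmod (f y) * b y)) //.
  by apply: cmeasurableM => //; exact: cmeasurable_secY.
have fc y : f y * cotransform g y = cint mu (fun x => F (x, y)).
  rewrite -(@cintZ _ _ _ mu _ (fun=> M * b y)) //.
  - by apply: eq_cint => x; rewrite /F /= mulrCA.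
  - by apply: cmeasurableM => //; exact: cmeasurable_secX.
  - by move=> x; rewrite cmodM ler_pM ?cmod_ge0.
  - exact: finite_measure_integrable_cst.
have iM : lam.-integrable setT (EFin \o (fun y => M * (cmod (f y) * b y))).
  exact: (integrableZl _ M ifb).
under eq_cint do rewrite gs.
under [RHS]eq_cint do rewrite fc.
case: mF => mr mi.
apply: complex_ext.
  apply: (Rintegral_swap mu mr _ iM) => x y.
  exact: le_trans (normr_Re_le _) (Fb _ _).
apply: (Rintegral_swap mu mi _ iM) => x y.
exact: le_trans (normr_Im_le _) (Fb _ _).
Qed.

End TransformPair.

(** * The Schur test *)
Section SchurTest.
Context dX (X : measurableType dX) {R : realType}.
Variables (mu : {finite_measure set X -> \bar R}).

Lemma bounded_integrable (h : X -> R) M : measurable_fun setT h ->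
  (forall x, `|h x| <= M) -> mu.-integrable setT (EFin \o h).
Proof.
move=> mh hM; apply: (dominated_integrable mh hM).
exact: finite_measure_integrable_cst.
Qed.

Lemma Rintegral_bound (h : X -> R) M : measurable_fun setT h ->
  (forall x, `|h x| <= M) -> `|\int[mu]_x h x| <= M * fine (mu setT).
Proof.
move=> mh hM; apply: le_trans (le_normr_Rintegral _ _) _ => //.
  exact: (bounded_integrable mh hM).
rewrite -Rintegral_cst //; apply: le_Rintegral => //.
  apply: (@bounded_integrable _ M); first exact: measurableT_comp.
  by move=> x; rewrite normr_id.
exact: finite_measure_integrable_cst.
Qed.

(** Since h(x) h(x') <= (h(x)^2 + h(x')^2) / 2, and both squares contribute the
    same amount by the symmetry of K. *)
Lemma schur_test (K : X * X -> R) (h : X -> R) (BK Bh C : R) :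
  measurable_fun setT K -> measurable_fun setT h ->
  (forall x x', 0 <= K (x, x') <= BK) -> (forall x, 0 <= h x <= Bh) ->
  (forall x x', K (x, x') = K (x', x)) ->
  (forall x, \int[mu]_x' K (x, x') <= C) ->
  \int[mu]_x (\int[mu]_x' (h x * h x' * K (x, x'))) <= C * \int[mu]_x (h x ^+ 2).
Proof.
move=> mK mh K0 h0 Ksym KC.
have mKs x : measurable_fun setT (fun x' => K (x, x')) by exact: measurableT_comp.
pose P z := h z.1 * h z.2 * K z.
pose Q z := h z.1 ^+ 2 * K z.
pose Q' z := h z.2 ^+ 2 * K z.
have mh1 : measurable_fun setT (fun z : X * X => h z.1) by exact: measurableT_comp.
have mh2 : measurable_fun setT (fun z : X * X => h z.2) by exact: measurableT_comp.
have mP : measurable_fun setT P by do 2 apply: measurable_funM => //.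
have mQ : measurable_fun setT Q by apply: measurable_funM => //; exact: measurable_funX.
have mQ' : measurable_fun setT Q' by apply: measurable_funM => //; exact: measurable_funX.
have hh x : 0 <= h x ^+ 2 <= Bh ^+ 2.
  by have /andP[? ?] := h0 x; rewrite sqr_ge0 lerXn2r // nnegrE (le_trans _ (_ : h x <= _)).
pose M := Bh ^+ 2 * BK.
have bQ z : `|Q z| <= M.
  case: z => x x'; have /andP[a1 a2] := hh x; have /andP[b1 b2] := K0 x x'.
  have q0 : 0 <= Q (x, x') by exact: mulr_ge0.
  by rewrite (ger0_norm q0) ler_pM.
have bQ' z : `|Q' z| <= M.
  case: z => x x'; have /andP[a1 a2] := hh x'; have /andP[b1 b2] := K0 x x'.
  have q0 : 0 <= Q' (x, x') by exact: mulr_ge0.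
  by rewrite (ger0_norm q0) ler_pM.
have PQ z : P z <= 2^-1 * (Q z + Q' z).
  case: z => x x'; have /andP[b1 b2] := K0 x x'; rewrite /P /Q /Q' /=.
  by have := mulr_ge0 b1 (sqr_ge0 (h x - h x')); lra.
have P0 z : 0 <= P z.
  case: z => x x'; have /andP[b1 b2] := K0 x x'; rewrite /P /=.
  by have /andP[? _] := h0 x; have /andP[? _] := h0 x'; rewrite !mulr_ge0.
have bP z : `|P z| <= M.
  rewrite ger0_norm //; apply: le_trans (PQ z) _.
  have := le_trans (ler_norm _) (bQ z); have := le_trans (ler_norm _) (bQ' z); lra.
have PE x x' : h x * h x' * K (x, x') = P (x, x') by [].
have QE x x' : Q (x, x') = h x ^+ 2 * K (x, x') by [].
have Q'E x x' : Q' (x, x') = Q (x', x) by rewrite QE Ksym.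
clearbody P Q Q' M.
have sec (F : X * X -> R) x : measurable_fun setT F ->
    measurable_fun setT (fun x' => F (x, x')) by move=> ?; exact: measurableT_comp.
have int1 (F : X * X -> R) x : measurable_fun setT F -> (forall z, `|F z| <= M) ->
    mu.-integrable setT (EFin \o (fun x' => F (x, x'))).
  move=> mF bF; apply: (@bounded_integrable _ M) => //; exact: sec.
have int2 (F : X * X -> R) : measurable_fun setT F -> (forall z, `|F z| <= M) ->
    mu.-integrable setT (EFin \o (fun x => \int[mu]_x' F (x, x'))).
  move=> mF bF; apply: (@bounded_integrable _ (M * fine (mu setT))) => //.
    exact: measurable_Rintegral_snd.
  by move=> x; apply: Rintegral_bound => //; exact: sec.
have swap : \int[mu]_x (\int[mu]_x' Q' (x, x')) = \int[mu]_x (\int[mu]_x' Q (x, x')).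
  rewrite (Rintegral_swap mu mQ' (b := cst M));
    [|by move=> x x'; exact: bQ'|exact: finite_measure_integrable_cst].
  by apply: eq_Rintegral => x _; apply: eq_Rintegral => x' _; exact: Q'E.
have iQQ x := integrableD measurableT (int1 _ x mQ bQ) (int1 _ x mQ' bQ').
have iIQQ := integrableD measurableT (int2 _ mQ bQ) (int2 _ mQ' bQ').
have half (f g : X -> R) :
    mu.-integrable setT ((EFin \o f) \+ (EFin \o g))%E ->
    mu.-integrable setT (EFin \o (fun x => 2^-1 * (f x + g x))).
  move=> ifg; have := integrableZl measurableT 2^-1 ifg.
  by apply: eq_integrable.
have step1 : \int[mu]_x (\int[mu]_x' P (x, x')) <= \int[mu]_x (\int[mu]_x' Q (x, x')).
  apply: (@le_trans _ _ (\int[mu]_x (2^-1 * (\int[mu]_x' Q (x, x') + \int[mu]_x' Q' (x, x'))))).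
    apply: le_Rintegral;
      [exact: measurableT|exact: int2|exact: half iIQQ|].
    move=> x _.
    rewrite -RintegralD; [|exact: measurableT|exact: int1|exact: int1].
    rewrite -RintegralZl; [|exact: measurableT|exact: iQQ].
    apply: le_Rintegral;
      [exact: measurableT|exact: int1|exact: half (iQQ x)|].
    by move=> x' _; exact: PQ.
  rewrite RintegralZl; [|exact: measurableT|exact: iIQQ].
  rewrite RintegralD; [|exact: measurableT|exact: int2|exact: int2].
  by rewrite swap -mulr2n -[X in _ * X]mulr_natl mulKf // pnatr_eq0.
rewrite (_ : Rintegral _ _ _ = \int[mu]_x (\int[mu]_x' P (x, x'))); last first.
  by apply: eq_Rintegral => x _; apply: eq_Rintegral => x' _; exact: PE.
apply: le_trans step1 _.
have ih2 : mu.-integrable setT (EFin \o (fun x => h x ^+ 2)).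
  apply: (@bounded_integrable _ (Bh ^+ 2)); first exact: measurable_funX.
  by move=> x; have /andP[? ?] := hh x; rewrite ger0_norm.
rewrite -RintegralZl; [|exact: measurableT|exact: ih2].
apply: le_Rintegral;
  [exact: measurableT|exact: int2|exact: (integrableZl _ C ih2)|].
move=> x _; under eq_Rintegral do rewrite QE.
rewrite RintegralZl; [|exact: measurableT|].
  by rewrite mulrC ler_wpM2r ?sqr_ge0.
apply: (@bounded_integrable _ BK); first exact: mKs.
by move=> x'; have /andP[? ?] := K0 x x'; rewrite ger0_norm.
Qed.

End SchurTest.

(** This is (k r a - c)^2 >= 0 when w = r is finite.  When w = +oo the right-hand
    side is infinite unless a = 0, in which case both sides vanish since the
    inverse of +oo is 0. *)
Lemma weighted_amgm (R : realType) (w : \bar R) (k a c : R) :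
  (0 < w)%E -> 0 < k -> 0 <= a -> 0 <= c ->
  ((2 * (a * c))%:E <= k%:E * ((a ^+ 2)%:E * w) + (k^-1 * (c ^+ 2 * fine (w^-1)%E))%:E)%E.
Proof.
move=> w0 k0 a0 c0; case: w w0 => [r| |] // r0.
  rewrite lte_fin in r0.
  rewrite inver gt_eqF //= -!EFinM -EFinD lee_fin.
  have kr : 0 < k * r by exact: mulr_gt0.
  rewrite -subr_ge0 (_ : _ - _ = (k * r)^-1 * (k * r * a - c) ^+ 2).
    by rewrite mulr_ge0 ?sqr_ge0 // invr_ge0 ltW.
  by field; rewrite !gt_eqF.
rewrite invey /= mulr0 mulr0 adde0.
have [->|an0] := eqVneq a 0; first by rewrite mul0r mulr0 expr0n mul0e mule0.
rewrite gt0_muley; last by rewrite lte_fin exprn_gt0 // lt_neqAle eq_sym an0.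
by rewrite gt0_muley ?leey // lte_fin.
Qed.

Lemma measurable_fine_inve d (T : measurableType d) (R : realType)
    (D : set T) (w : T -> \bar R) : (forall y, D y -> (0 < w y)%E) ->
  measurable_fun D w -> measurable_fun D (fun y => fine (w y)^-1%E).
Proof.
(* fine +oo = 0 and 0^-1 = 0, so the inverse can be taken after fine. *)
move=> w0 mw; apply: (@eq_measurable_fun _ _ _ _ _ (fun y => fine (w y) `^ (- 1))).
  move=> y /set_mem Dy; have wy := w0 y Dy.
  rewrite powR_inv1 ?fine_ge0 1?ltW //.
  by case: (w y) wy => [r _| _|//]; rewrite ?fine_invr // invey /= invr0.
apply: (measurableT_comp (measurable_powR (- 1))).
by apply: measurableT_comp => //; exact: fine_measurable.
Qed.

(** * The bound for an operator whose Gram kernel passes the Schur test *)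
Section TTstar.
Context dX dY (X : measurableType dX) (Y : measurableType dY) {R : realType}.
Variables (mu : {finite_measure set X -> \bar R}).
Variables (lam : {sigma_finite_measure set Y -> \bar R}).
Variables (e : X * Y -> R[i]) (b : Y -> R) (w : Y -> \bar R).
Hypotheses (me : cmeasurable e) (eb : forall x y, cmod (e (x, y)) <= b y).
Hypotheses (mb : measurable_fun setT b) (mw : measurable_fun setT w).
Hypothesis (w0 : forall y, (0 < w y)%E).
Let v y := fine (w y)^-1%E.
Hypothesis (ibv : lam.-integrable setT (EFin \o (fun y => b y ^+ 2 * v y))).

(** gram x x' = int conj (e(x, y)) e(x', y) / w(y) dy, the reproducing kernel of
    the range of the operator on L^2(w), and the kernel of T T^*. *)
Definition gram (x x' : X) : R[i] :=
  transform lam e (fun y => (v y)%:C%C * conjc (e (x, y))) x'.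

Let v0 y : 0 <= v y.
Proof. by rewrite fine_ge0 // inve_ge0 ltW. Qed.

Let mv : measurable_fun setT v.
Proof. exact: measurable_fine_inve. Qed.

Let b0 := bound_ge0 eb.

Let v_e x y := (v y)%:C%C * conjc (e (x, y)).

Let cmeasurable_ve x : cmeasurable (v_e x).
Proof.
apply: cmeasurableM; first exact: cmeasurable_real.
by apply: cmeasurable_conj; exact: cmeasurable_secY.
Qed.

Let integrable_ve x :
  lam.-integrable setT (EFin \o (fun y => cmod (v_e x y) * b y)).
Proof.
apply: (dominated_integrable _ _ ibv).
  by apply: measurable_funM => //; exact: measurable_cmod.
move=> y; rewrite ger0_norm ?mulr_ge0 ?cmod_ge0 //.
rewrite cmodM cmod_real // cmodJ mulrC expr2 -mulrA ler_wpM2l //.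
by rewrite mulrC ler_wpM2r.
Qed.

Lemma gram_sym x x' : gram x' x = conjc (gram x x').
Proof.
rewrite /gram /transform -(cint_conj (b := fun y => b y ^+ 2 * v y)) //.
- by apply: eq_cint => y; apply: complex_ext; rewrite !(cReM, cImM, cReJ, cImJ) /=; ring.
- by apply: cmeasurableM (cmeasurable_ve _) _; exact: cmeasurable_secY.
- move=> y; rewrite !cmodM cmod_real // cmodJ [leRHS]mulrC -mulrA.
  by rewrite expr2 ler_wpM2l // ler_pM ?cmod_ge0.
Qed.

Lemma cmod_gram_le x x' : cmod (gram x x') <= \int[lam]_y (b y ^+ 2 * v y).
Proof.
apply: le_trans (cmod_transform_le _ eb _ (cmeasurable_ve x) (integrable_ve x)) _ => //.
apply: le_Rintegral => // y _.
rewrite cmodM cmod_real // cmodJ mulrC expr2 -mulrA ler_wpM2l //.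
by rewrite mulrC ler_wpM2r.
Qed.

Lemma cmeasurable_gram : cmeasurable (fun z : X * X => gram z.1 z.2).
Proof.
have mF : cmeasurable (fun z : (X * X) * Y =>
    (v z.2)%:C%C * conjc (e (z.1.1, z.2)) * e (z.1.2, z.2)).
  apply: cmeasurableM; first apply: cmeasurableM.
  - by apply: cmeasurable_real; exact: measurableT_comp.
  - apply: cmeasurable_conj; apply: (cmeasurable_comp me).
    by apply: measurable_fun_pair => //; exact: measurableT_comp.
  - apply: (cmeasurable_comp me).
    by apply: measurable_fun_pair => //; exact: measurableT_comp.
by case: mF => mr mi; split; [exact: (measurable_Rintegral_snd _ mr)|exact: (measurable_Rintegral_snd _ mi)].
Qed.

Section Function.
Variable f : Y -> R[i].
Hypothesis mf : cmeasurable f.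
Let N := (\int[lam]_y (((cmod (f y)) ^+ 2)%:E * w y))%E.
Hypothesis Noo : (N < +oo)%E.

Let mfw : measurable_fun setT (fun y => ((cmod (f y)) ^+ 2)%:E * w y)%E.
Proof.
apply: emeasurable_funM => //; apply/measurable_EFinP.
by apply: measurable_funX; exact: measurable_cmod.
Qed.

Let fw0 y : (0 <= ((cmod (f y)) ^+ 2)%:E * w y)%E.
Proof. by rewrite mule_ge0 ?lee_fin ?sqr_ge0 // ltW. Qed.

(** Cauchy-Schwarz in the additive form with a parameter k, which remains
    meaningful for weights with infinite values. *)
Lemma integral_pairing_le (k : R) (c : Y -> R) : 0 < k ->
  measurable_fun setT c -> (forall y, 0 <= c y) ->
  (\int[lam]_y (2 * (cmod (f y) * c y))%:E <=
   k%:E * N + \int[lam]_y (k^-1 * (c y ^+ 2 * v y))%:E)%E.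
Proof.
move=> k0 mc c0.
have mcv : measurable_fun setT (fun y => k^-1 * (c y ^+ 2 * v y)).
  do 2 apply: measurable_funM => //; exact: measurable_funX.
rewrite -ge0_integralZl //; last by rewrite lee_fin ltW.
have kfw0 y : (0 <= k%:E * (((cmod (f y)) ^+ 2)%:E * w y))%E.
  by rewrite mule_ge0 // lee_fin ltW.
have cv0 y : (0 <= (k^-1 * (c y ^+ 2 * v y))%:E)%E.
  by rewrite lee_fin !mulr_ge0 ?sqr_ge0 // invr_ge0 ltW.
rewrite -ge0_integralD //; first last.
- exact/measurable_EFinP.
- exact: measurable_funeM.
apply: ge0_le_integral => //.
- by move=> y _; rewrite lee_fin !mulr_ge0 ?cmod_ge0.
- apply/measurable_EFinP; apply: measurable_funM => //; apply: measurable_funM => //.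
  exact: measurable_cmod.
- apply: emeasurable_funD; first exact: measurable_funeM.
  exact/measurable_EFinP.
- by move=> y _; apply: weighted_amgm; rewrite ?cmod_ge0.
Qed.

Lemma integrable_pairing :
  lam.-integrable setT (EFin \o (fun y => cmod (f y) * b y)).
Proof.
have mfb : measurable_fun setT (fun y => 2 * (cmod (f y) * b y)).
  by do 2 apply: measurable_funM => //; exact: measurable_cmod.
have h : lam.-integrable setT (EFin \o (fun y => 2 * (cmod (f y) * b y))).
  apply/integrableP; split; first exact/measurable_EFinP.
  under eq_integral => y _.
    rewrite gee0_abs /=; last by rewrite lee_fin !mulr_ge0 ?cmod_ge0.
    over.
  apply: (le_lt_trans (integral_pairing_le ltr01 mb b0)).
  rewrite mul1e; apply: lte_add_pinfty => //.
  under eq_integral do rewrite invr1 mul1r.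
  exact: (integrable_lty _ ibv).
have := integrableZl measurableT 2^-1 h.
by apply: eq_integrable => // y _ /=; rewrite -EFinM mulKf ?pnatr_eq0.
Qed.

(** With g = T f, S = int |g|^2 and H the transpose of T at conj g, the pairing
    int f H equals S, while A = int |H|^2 / w is the quadratic form of [gram] at g,
    so that A <= C S by the Schur test.  Then
    2 S <= C N + A / C <= C N + S, where N = int |f|^2 w. *)
Lemma transform_sqr_le (C : R) : 0 < C ->
  (forall x, (\int[mu]_x' (cmod (gram x x'))%:E <= C%:E)%E) ->
  (\int[mu]_x ((cmod (transform lam e f x)) ^+ 2)%:E <= C%:E * N)%E.
Proof.
move=> C0 hC.
set g := transform lam e f.
have mg : cmeasurable g by exact: cmeasurable_transform.
have ifb := integrable_pairing.
pose M := \int[lam]_y (cmod (f y) * b y).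
have gM x : cmod (g x) <= M by exact: cmod_transform_le.
have M0 : 0 <= M by exact: le_trans (cmod_ge0 _) (gM point).
have mcg : measurable_fun setT (fun x => cmod (g x)) by exact: measurable_cmod.
pose G x := conjc (g x).
have mG : cmeasurable G by exact: cmeasurable_conj.
have GM x : cmod (G x) <= M by rewrite cmodJ.
pose H := cotransform mu e G.
have mH : cmeasurable H by exact: cmeasurable_cotransform.
pose M' := M * fine (mu setT).
have HM y : cmod (H y) <= M' * b y by exact: cmod_cotransform_le.
have M'0 : 0 <= M' by rewrite mulr_ge0 // fine_ge0.
have Mb0 y : 0 <= M' * b y by exact: mulr_ge0.
have mcH : measurable_fun setT (fun y => cmod (H y)) by exact: measurable_cmod.
pose S := \int[mu]_x (cmod (g x) ^+ 2).
have ig2 : mu.-integrable setT (EFin \o (fun x => cmod (g x) ^+ 2)).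
  apply: (@bounded_integrable _ _ _ _ _ (M ^+ 2)); first exact: measurable_funX.
  by move=> x; rewrite ger0_norm ?sqr_ge0 // lerXn2r // nnegrE cmod_ge0.
pose A := \int[lam]_y (cmod (H y) ^+ 2 * v y).
have mHv : measurable_fun setT (fun y => cmod (H y) ^+ 2 * v y).
  by apply: measurable_funM => //; exact: measurable_funX.
have iA : lam.-integrable setT (EFin \o (fun y => cmod (H y) ^+ 2 * v y)).
  apply: (dominated_integrable (b := fun y => M' ^+ 2 * (b y ^+ 2 * v y)) mHv _
    (integrableZl measurableT (M' ^+ 2) ibv)).
  move=> y; rewrite ger0_norm ?mulr_ge0 ?exprn_ge0 ?cmod_ge0 // [leRHS]mulrA.
  by rewrite ler_wpM2r // -exprMn lerXn2r ?nnegrE ?Mb0 ?cmod_ge0.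
have SE : S = \int[lam]_y complex.Re (f y * H y).
  rewrite -(Re_cint lam (fun y => f y * H y)) -(transform_swap mu me eb mf mG GM ifb) Re_cint.
  by apply: eq_Rintegral => x _; rewrite Re_conjM.
(* f0 is T^* g for the weighted space L^2(w), so T f0 = T T^* g. *)
pose f0 y := (v y)%:C%C * conjc (H y).
have mf0 : cmeasurable f0.
  apply: cmeasurableM; first exact: cmeasurable_real.
  exact: cmeasurable_conj.
have if0 : lam.-integrable setT (EFin \o (fun y => cmod (f0 y) * b y)).
  apply: (dominated_integrable (b := fun y => M' * (b y ^+ 2 * v y)) _ _
    (integrableZl measurableT M' ibv)).
    by apply: measurable_funM => //; exact: measurable_cmod.
  move=> y; rewrite ger0_norm ?mulr_ge0 ?cmod_ge0 //.
  rewrite cmodM cmod_real // cmodJ (_ : M' * _ = v y * (M' * b y) * b y); last by ring.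
  by rewrite ler_wpM2r // ler_wpM2l.
have AE : A = \int[mu]_x complex.Re (G x * transform lam e f0 x).
  rewrite -(Re_cint mu (fun x => G x * transform lam e f0 x)).
  rewrite (transform_swap mu me eb mf0 mG GM if0) Re_cint.
  apply: eq_Rintegral => y _; rewrite /f0 -mulrA cReM Re_conjM /= mul0r subr0.
  by rewrite mulrC.
have dual x : conjc (transform lam e f0 x) = cint mu (fun x' => G x' * gram x x').
  rewrite (transform_swap mu me eb (cmeasurable_ve x) mG GM (integrable_ve x)).
  rewrite /transform -(cint_conj (b := fun y => cmod (f0 y) * b y)) //.
  - apply: eq_cint => y; rewrite /f0 /v_e.
    by apply: complex_ext; rewrite !(cReM, cImM, cReJ, cImJ) /=; ring.
  - by apply: cmeasurableM => //; exact: cmeasurable_secY.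
  - by move=> y; rewrite cmodM ler_wpM2l ?cmod_ge0.
pose B := \int[lam]_y (b y ^+ 2 * v y).
have mK : measurable_fun setT (fun z : X * X => cmod (gram z.1 z.2)).
  exact: (measurable_cmod cmeasurable_gram).
have mgr x : cmeasurable (gram x) by apply: cmeasurable_transform => //; exact: cmeasurable_ve.
have mKs x : measurable_fun setT (fun x' => cmod (gram x x')).
  exact: measurable_cmod (mgr x).
have iK x : mu.-integrable setT (EFin \o (fun x' => cmod (gram x x'))).
  apply: (@bounded_integrable _ _ _ _ _ B) => // x'.
  by rewrite ger0_norm ?cmod_ge0 // cmod_gram_le.
have KC x : \int[mu]_x' cmod (gram x x') <= C.
  rewrite -lee_fin /Rintegral fineK; first exact: hC.
  exact: integrable_fin_num (iK x).
have mP : measurable_fun setT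
    (fun z : X * X => cmod (g z.1) * cmod (g z.2) * cmod (gram z.1 z.2)).
  by do 2 apply: measurable_funM => //; exact: (measurableT_comp mcg).
have bP x x' : `|cmod (g x) * cmod (g x') * cmod (gram x x')| <= M * M * B.
  rewrite ger0_norm ?mulr_ge0 ?cmod_ge0 //.
  by rewrite ler_pM ?mulr_ge0 ?cmod_ge0 ?cmod_gram_le // ler_pM ?cmod_ge0.
have AS : A <= C * S.
  apply: le_trans (schur_test (K := fun z => cmod (gram z.1 z.2))
    (h := fun x => cmod (g x)) (BK := B) (Bh := M) (C := C) _ _ _ _ _ _) => //.
  - rewrite AE; apply: le_Rintegral => //.
    + apply: (@bounded_integrable _ _ _ _ _ (M * \int[lam]_y (cmod (f0 y) * b y))).
        by have [] := cmeasurableM mG (cmeasurable_transform lam me mf0).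
      move=> x; apply: le_trans (normr_Re_le _) _.
      by rewrite cmodM ler_pM ?cmod_ge0 // cmod_transform_le.
    + apply: (@bounded_integrable _ _ _ _ _ (M * M * B * fine (mu setT))).
        exact: (measurable_Rintegral_snd _ mP).
      move=> x; apply: Rintegral_bound => //.
      exact: (measurableT_comp mP (pair1_measurable x)).
    + move=> x _.
      have mGg : cmeasurable (fun x' => G x' * gram x x').
        exact: cmeasurableM.
      have GgM x' : cmod (G x' * gram x x') <= M * B.
        rewrite cmodM; apply: ler_pM; [exact: cmod_ge0|exact: cmod_ge0|exact: GM|].
        exact: cmod_gram_le.
      rewrite -cReJ conjcM dual conjcK.
      rewrite -(cintZ (b := cst (M * B))) //; last exact: finite_measure_integrable_cst.
      rewrite Re_cint; apply: le_Rintegral => //.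
      * apply: (@bounded_integrable _ _ _ _ _ (M * (M * B))).
          by have [] := cmeasurableM (cmeasurable_cst X (g x)) mGg.
        move=> x'; apply: le_trans (normr_Re_le _) _.
        by rewrite cmodM; apply: ler_pM; rewrite ?cmod_ge0 ?gM ?GgM.
      * apply: (@bounded_integrable _ _ _ _ _ (M * M * B)) => //.
        exact: (measurableT_comp mP (pair1_measurable x)).
      * by move=> x' _; rewrite (le_trans (Re_le_cmod _)) // !cmodM cmodJ mulrA.
  - by move=> x x'; rewrite cmod_ge0 cmod_gram_le.
  - by move=> x; rewrite cmod_ge0 gM.
  - by move=> x x'; exact: etrans (congr1 _ (gram_sym x' x)) (cmodJ _).
have SfinE : (\int[mu]_x ((cmod (g x)) ^+ 2)%:E)%E = S%:E.
  by rewrite /S /Rintegral fineK // integrable_fin_num.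
rewrite SfinE.
have S2 : ((2 * S)%:E <= C%:E * N + (C^-1 * A)%:E)%E.
  have := integral_pairing_le C0 mcH (fun y => cmod_ge0 _).
  rewrite (_ : (\int[lam]_y (C^-1 * _)%:E)%E = (C^-1 * A)%:E); last first.
    rewrite -RintegralZl // /Rintegral fineK // integrable_fin_num //.
    exact: (integrableZl _ C^-1 iA).
  apply: le_trans.
  have iFH : lam.-integrable setT (EFin \o (fun y => cmod (f y) * cmod (H y))).
    apply: (dominated_integrable (b := fun y => M' * (cmod (f y) * b y)) _ _
      (integrableZl measurableT M' ifb)).
      by apply: measurable_funM => //; exact: measurable_cmod.
    move=> y; rewrite ger0_norm ?mulr_ge0 ?cmod_ge0 //.
    by rewrite [leRHS]mulrCA ler_wpM2l ?cmod_ge0.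
  have iFH2 := integrableZl measurableT 2 iFH.
  rewrite -[leRHS]fineK; last exact: (integrable_fin_num _ iFH2).
  rewrite lee_fin -[fine _]/(\int[lam]_y (2 * (cmod (f y) * cmod (H y)))).
  rewrite RintegralZl // ler_wpM2l // SE; apply: le_Rintegral => //.
    apply: (dominated_integrable _ _ iFH); first by case: (cmeasurableM mf mH).
    by move=> y; rewrite -cmodM normr_Re_le.
  by move=> y _; rewrite -cmodM Re_le_cmod.
have Nfin : N \is a fin_num by rewrite ge0_fin_numE // integral_ge0.
move: S2; rewrite -(fineK Nfin) -!EFinM -EFinD !lee_fin => S2.
have : C^-1 * A <= S by rewrite ler_pdivrMl.
lra.
Qed.

End Function.
End TTstar.

(** * The complex plane and the complex exponential *)
Section BorelC.
Context {R : realType}.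

Lemma open_preimage_1Lipschitz (p : R[i] -> R) :
  (forall x y, `|p x - p y| <= cmod (x - y)) ->
  forall A : set R, open A -> @open R[i]^o (p @^-1` A).
Proof.
move=> lip A oA; rewrite openE => z /= Apz.
have : nbhs (p z) A by rewrite nbhsE /=; exists A.
move=> /nbhs_ballP[r /= r0 rA].
apply/nbhs_ballP; exists (r%:C%C) => /=; first by rewrite ltcR.
move=> u; rewrite /ball /= => zu.
apply: rA; rewrite /ball /=.
apply: le_lt_trans (lip _ _) _.
by move: zu; rewrite normc_def ltcR; case: (z - u).
Qed.

Lemma measurable_1Lipschitz (p : R[i] -> R) :
  (forall x y, `|p x - p y| <= cmod (x - y)) ->
  @measurable_fun _ _ (borelC R) R setT p.
Proof.
move=> lip; apply: (measurability _ (RGenOpens.measurableE R)).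
move=> _ [_ [a [b ->] <-]].
rewrite setTI; apply: sub_sigma_algebra.
apply: (open_preimage_1Lipschitz lip); exact: interval_open.
Qed.

Lemma measurable_Re : @measurable_fun _ _ (borelC R) R setT (@complex.Re R).
Proof.
apply: measurable_1Lipschitz => x y.
by apply: le_trans (normr_Re_le (x - y)); case: x y => a b [c d].
Qed.

Lemma measurable_Im : @measurable_fun _ _ (borelC R) R setT (@complex.Im R).
Proof.
apply: measurable_1Lipschitz => x y.
by apply: le_trans (normr_Im_le (x - y)); case: x y => a b [c d].
Qed.

Lemma measurable_ReGe (s : R) : measurable [set z : borelC R | s <= complex.Re z].
Proof.
rewrite (_ : [set _ | _] = setT `&` (@complex.Re R : borelC R -> R) @^-1` `[s, +oo[%classic).
  exact: (measurable_Re measurableT).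
by rewrite setTI; apply/seteqP; split => z /=; rewrite in_itv /= andbT.
Qed.

Lemma measurable_Cplus : measurable (@Cplus R).
Proof.
rewrite (_ : @Cplus R = setT `&` (@complex.Re R : borelC R -> R) @^-1` `]0, +oo[%classic).
  exact: (measurable_Re measurableT).
by rewrite setTI; apply/seteqP; split => z /=; rewrite /Cplus /= in_itv /= andbT.
Qed.

Lemma cmod_cexp (z : R[i]) : cmod (cexp z) = expR (complex.Re z).
Proof.
apply/eqP; rewrite -(eqrXn2 (n := 2)) ?cmod_ge0 ?expR_ge0 //.
by rewrite cmod_sqr /= !exprMn -mulrDr cos2Dsin2 mulr1.
Qed.

Lemma cexpD (z u : R[i]) : cexp (z + u) = cexp z * cexp u.
Proof.
case: z u => a b [c d]; rewrite /cexp /= expRD cosD sinD.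
by apply: complex_ext; rewrite ?cReM ?cImM /=; ring.
Qed.

Lemma cexpJ (z : R[i]) : cexp (conjc z) = conjc (cexp z).
Proof. by case: z => a b; rewrite /cexp /= cosN sinN; congr Complex; rewrite mulrN. Qed.

End BorelC.

(** * The Laplace transform as an integral operator *)
Section LaplaceKernel.
Context {R : realType}.
Notation Y := (measurableTypeR R).
Notation lam := (@lebesgue_measure R).
Notation D := (`]0, +oo[%classic : set Y).
Implicit Types (z : borelC R) (t : Y).

Lemma Re_expo t (z : R[i]) : complex.Re (- (t%:C%C * z)) = - (t * complex.Re z).
Proof. by case: z => a b /=; rewrite mul0r subr0. Qed.

Lemma Im_expo t (z : R[i]) : complex.Im (- (t%:C%C * z)) = - (t * complex.Im z).
Proof. by case: z => a b /=; rewrite mul0r addr0. Qed.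

(** Cut off outside (0, +oo), so that integrals over the half-line become
    integrals over the whole line. *)
Definition laplace_kernel (p : borelC R * Y) : R[i] :=
  (\1_D p.2)%:C%C * cexp (- (p.2%:C%C * p.1)).

Lemma measurable_halfline : measurable D.
Proof. exact: measurable_itv. Qed.

Lemma cmeasurable_cexp_expo :
  cmeasurable (fun p : borelC R * Y => cexp (- (p.2%:C%C * p.1))).
Proof.
have mR : measurable_fun setT (fun p : borelC R * Y => - (p.2 * complex.Re p.1)).
  apply: measurable_funN; apply: measurable_funM => //.
  by apply: (measurableT_comp measurable_Re).
have mI : measurable_fun setT (fun p : borelC R * Y => - (p.2 * complex.Im p.1)).
  apply: measurable_funN; apply: measurable_funM => //.
  by apply: (measurableT_comp measurable_Im).
have mE := measurableT_comp (@measurable_expR R) mR.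
split.
  rewrite (_ : (fun _ => _) = fun p => expR (- (p.2 * complex.Re p.1)) *
     cos (- (p.2 * complex.Im p.1))); last first.
    by apply/funext => p; rewrite /cexp /= Re_expo Im_expo.
  apply: measurable_funM => //.
  apply: (measurableT_comp (continuous_measurable_fun _)) => //.
  exact: continuous_cos.
rewrite (_ : (fun _ => _) = fun p => expR (- (p.2 * complex.Re p.1)) *
   sin (- (p.2 * complex.Im p.1))); last first.
  by apply/funext => p; rewrite /cexp /= Re_expo Im_expo.
apply: measurable_funM => //.
apply: (measurableT_comp (continuous_measurable_fun _)) => //.
exact: continuous_sin.
Qed.

Lemma cmeasurable_laplace_kernel : cmeasurable laplace_kernel.
Proof.
apply: cmeasurableM cmeasurable_cexp_expo; apply: cmeasurable_real.
exact: measurableT_comp.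
Qed.

Lemma cmod_laplace_kernel z t : cmod (laplace_kernel (z, t)) = \1_D t * expR (- (t * complex.Re z)).
Proof. by rewrite cmodM cmod_real // cmod_cexp Re_expo. Qed.

Definition halfline_part (f : Y -> R[i]) (t : Y) : R[i] := (\1_D t)%:C%C * f t.

Lemma Re_halfline_part f t : complex.Re (halfline_part f t) = ((fun t => complex.Re (f t)) \_ D) t.
Proof.
rewrite /halfline_part cReM /= mul0r subr0 indicE patchE.
by case: ifP; rewrite ?mul1r ?mul0r.
Qed.

Lemma Im_halfline_part f t : complex.Im (halfline_part f t) = ((fun t => complex.Im (f t)) \_ D) t.
Proof.
rewrite /halfline_part cImM /= mul0r addr0 indicE patchE.
by case: ifP; rewrite ?mul1r ?mul0r.
Qed.

Lemma cintegral_halfline_part (f : Y -> R[i]) : cintegral D f = cint lam (halfline_part f).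
Proof.
apply: complex_ext; rewrite /cintegral /cint /= Rintegral_mkcond;
  by apply: eq_Rintegral => t _; rewrite (Re_halfline_part, Im_halfline_part).
Qed.

Lemma LaplaceE (f : Y -> R[i]) z : Laplace f z = transform lam laplace_kernel (halfline_part f) z.
Proof.
rewrite /Laplace cintegral_halfline_part; apply: eq_cint => t.
rewrite /laplace_kernel /halfline_part /= indicE; case: (t \in D) => /=; last by rewrite !mul0r.
by rewrite !mul1r.
Qed.

Lemma cmeasurable_halfline_part (f : Y -> R[i]) :
  measurable_fun D (fun t => complex.Re (f t)) ->
  measurable_fun D (fun t => complex.Im (f t)) -> cmeasurable (halfline_part f).
Proof.
move=> mr mi; split.
  under eq_fun do rewrite Re_halfline_part.
  exact: (measurable_restrictT _ measurable_halfline).1 mr.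
under eq_fun do rewrite Im_halfline_part.
exact: (measurable_restrictT _ measurable_halfline).1 mi.
Qed.

Lemma cmeasurable_Laplace (f : Y -> R[i]) : cmeasurable (halfline_part f) ->
  cmeasurable (Laplace f).
Proof.
move=> mf; rewrite (_ : Laplace f = transform lam laplace_kernel (halfline_part f)).
  by apply: cmeasurable_transform => //; exact: cmeasurable_laplace_kernel.
by apply/funext => z; exact: LaplaceE.
Qed.

Lemma L2_cmeasurable (w : R -> \bar R) f : L2 w f -> cmeasurable (halfline_part f).
Proof.
move=> [mf _]; apply: cmeasurable_halfline_part.
  exact: (measurableT_comp measurable_Re mf).
exact: (measurableT_comp measurable_Im mf).
Qed.

End LaplaceKernel.

(** * Weights with integrable inverse *)
Section Restriction.
Context d (T : measurableType d) {R : realType} (mu : {measure set T -> \bar R}).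

Lemma integral_mfrestr (E : set T) (mE : measurable E) (muE : (mu E < +oo)%E)
    (F : T -> \bar R) : (forall x, ~ E x -> F x = 0%E) ->
  (\int[mfrestr mE muE]_x F x = \int[mu]_(x in E) F x)%E.
Proof.
move=> F0; have FE : F = F \_ E.
  apply/funext => x; rewrite patchE; case: ifPn => //.
  by move=> /negP; rewrite inE => /F0.
rewrite [in LHS]FE -integral_mkcond; apply: eq_measure_integral => A mA AE.
by rewrite /= /mfrestr /mrestr setIidl.
Qed.

End Restriction.

Section Weighted.
Context {R : realType}.
Notation Y := (measurableTypeR R).
Notation lam := (@lebesgue_measure R).
Notation D := (`]0, +oo[%classic : set Y).
Variable w : R -> \bar R.
Hypotheses (mw : measurable_fun D w) (w0 : forall t, 0 < t -> (0 < w t)%E).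
Let v t := fine (w t)^-1%E.
Hypothesis ive : forall s, 0 < s ->
  lam.-integrable D (EFin \o (fun t => expR (- (s * t)) * v t)).

Lemma mem_halfline (t : R) : (t \in D) = (0 < t).
Proof. by apply/idP/idP; rewrite inE /= in_itv /= andbT. Qed.

Lemma indic_halfline (t : R) : \1_D t = (0 < t)%R%:R :> R.
Proof. by rewrite indicE mem_halfline. Qed.

(** A weight that is positive on the whole line, for kernels that vanish outside
    the half-line. *)
Let wD (t : R) : \bar R := if 0 < t then w t else 1%E.

Let mwD : measurable_fun setT wD.
Proof.
have mD : measurable D by exact: measurable_halfline.
rewrite (_ : wD = fun t => ((w \_ D) t + (\1_(~` D) t)%:E)%E).
  apply: emeasurable_funD; first exact: (measurable_restrictT _ mD).1 mw.
  by apply/measurable_EFinP; apply: measurable_indic; exact: measurableC.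
apply/funext => t; rewrite /wD patchE indicE in_setC mem_halfline.
by case: (0 < t); rewrite /= ?adde0 ?add0e.
Qed.

Let wD0 (t : R) : (0 < wD t)%E.
Proof. by rewrite /wD; case: ifP => // /w0. Qed.

Lemma A2kernelE (z zeta : borelC R) : A2kernel w z zeta =
  Laplace (fun t => (v t)%:C%C * conjc (cexp (- (t%:C%C * z)))) zeta.
Proof.
rewrite /A2kernel /Laplace; congr cintegral; apply/funext => t.
rewrite mulrDr opprD cexpD -cexpJ mulrC mulrA; congr (_ * cexp _ * _).
by apply: complex_ext; rewrite ?cReJ ?cImJ !(Re_expo, Im_expo) ?cReJ ?cImJ // mulrN.
Qed.

Let mv : measurable_fun D v.
Proof.
apply: measurable_fine_inve => // t; rewrite /= in_itv /= andbT; exact: w0.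
Qed.

Lemma cmeasurable_cexp (z : borelC R) :
  cmeasurable (fun t : Y => cexp (- (t%:C%C * z))).
Proof.
exact: (cmeasurable_comp cmeasurable_cexp_expo (pair1_measurable z)).
Qed.

Lemma cmeasurable_kernel z : cmeasurable (A2kernel w z).
Proof.
rewrite (_ : A2kernel w z = Laplace (fun t => (v t)%:C%C * conjc (cexp (- (t%:C%C * z))))).
  apply: cmeasurable_Laplace; apply: cmeasurable_halfline_part.
    apply: (@eq_measurable_fun _ _ _ _ _
      (fun t => v t * complex.Re (conjc (cexp (- (t%:C%C * z)))))).
      by move=> t _; rewrite [RHS]cReM mul0r subr0.
    apply: measurable_funM => //; apply: measurable_funTS.
    by have [] := cmeasurable_conj (cmeasurable_cexp z).
  apply: (@eq_measurable_fun _ _ _ _ _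
      (fun t => v t * complex.Im (conjc (cexp (- (t%:C%C * z)))))).
      by move=> t _; rewrite [RHS]cImM mul0r addr0.
  apply: measurable_funM => //; apply: measurable_funTS.
  by have [] := cmeasurable_conj (cmeasurable_cexp z).
by apply/funext => zeta; exact: A2kernelE.
Qed.

Lemma L2_lty f : L2 w f ->
  (\int[lam]_(t in D) (((cmod (f t)) ^+ 2)%:E * w t) < +oo)%E.
Proof.
by move=> [_]; apply: lty_poweRy; rewrite invr_eq0 pnatr_eq0.
Qed.

Section OnSet.
Variables (mu : {measure set (borelC R) -> \bar R}) (C : R).
Hypothesis C0 : 0 < C.
Hypothesis hC : forall z, @Cplus R z ->
  (\int[mu]_(zeta in @Cplus R) (cmod (A2kernel w z zeta))%:E <= C%:E)%E.
Variables (E : set (borelC R)) (delta : R).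
Hypotheses (mE : measurable E) (delta0 : 0 < delta) (muE : (mu E < +oo)%E).
Hypothesis Edelta : forall z, E z -> delta <= complex.Re z.

(** The operator bound for mu restricted to E.  On E the kernel is dominated by
    exp (- t delta), so that transforms are bounded, and multiplying it by the
    indicator of E makes this domination valid everywhere. *)
Lemma Laplace_sqr_le (f : Y -> R[i]) : L2 w f ->
  (\int[mu]_(z in E) ((cmod (Laplace f z)) ^+ 2)%:E <=
   C%:E * \int[lam]_(t in D) (((cmod (f t)) ^+ 2)%:E * w t))%E.
Proof.
move=> fL2.
pose e (p : borelC R * Y) : R[i] := (\1_E p.1)%:C%C * laplace_kernel p.
have eE z t : e (z, t) = (\1_E z)%:C%C * ((\1_D t)%:C%C * cexp (- (t%:C%C * z))) by [].
pose b (t : R) : R := \1_D t * expR (- (t * delta)).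
have me : cmeasurable e.
  apply: cmeasurableM cmeasurable_laplace_kernel; apply: cmeasurable_real.
  by apply: measurableT_comp => //; exact: measurable_indic.
have mb : measurable_fun setT b.
  apply: measurable_funM; first exact: measurable_indic.
  apply: measurableT_comp => //; apply: measurable_funN.
  exact: measurable_funM.
have eb z t : cmod (e (z, t)) <= b t.
  rewrite cmodM cmod_real // cmod_laplace_kernel /b /= indic_halfline indicE.
  case: ltP => t0; last by rewrite !mul0r mulr0.
  rewrite !mul1r; case: (boolP (z \in E)) => zE; last by rewrite mul0r expR_ge0.
  by rewrite mul1r ler_expR lerN2 ler_pM2l //; exact: Edelta (set_mem zE).
have ibv : lam.-integrable setT (EFin \o (fun t => b t ^+ 2 * fine (wD t)^-1%E)).
  have delta2 : 0 < 2 * delta by rewrite mulr_gt0.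
  have := (integrable_mkcond _ measurable_halfline).1 (ive delta2).
  apply: eq_integrable => // t _.
  rewrite patchE mem_halfline /= /b indic_halfline /wD; case: ifPn => t0 /=; last first.
    by rewrite mul0r expr0n mul0r.
  by rewrite mul1r expr2 -expRD; congr (expR _ * _)%:E; ring.
have mtf := L2_cmeasurable fL2.
pose N := (\int[lam]_t (((cmod (halfline_part f t)) ^+ 2)%:E * wD t))%E.
have NE : N = (\int[lam]_(t in D) (((cmod (f t)) ^+ 2)%:E * w t))%E.
  rewrite integral_mkcond; apply: eq_integral => t _.
  rewrite patchE mem_halfline /halfline_part indic_halfline /wD; case: ifPn => t0; rewrite ?mul1r //.
  by rewrite mul0r cmod0 expr0n mul0e.
have Noo : (N < +oo)%E by rewrite NE; exact: L2_lty.
pose muE' := mfrestr mE muE.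
have transformE g z : transform lam e g z = (\1_E z)%:C%C * transform lam laplace_kernel g z.
  rewrite indicE; case: (boolP (z \in E)) => zE.
    by rewrite mul1r; apply: eq_cint => t; rewrite /e /= indicE zE mul1r.
  rewrite mul0r /transform (_ : (fun _ => _) = fun=> 0) ?cint0 //.
  by apply/funext => t; rewrite /e /= indicE (negbTE zE) mul0r mulr0.
have gramE z z' : gram lam e wD z z' =
  (\1_E z)%:C%C * ((\1_E z')%:C%C * A2kernel w z z').
  rewrite /gram transformE mulrCA; congr (_ * _).
  rewrite A2kernelE LaplaceE indicE; case: (boolP (z \in E)) => zE.
    rewrite mul1r; apply: eq_cint => t; congr (_ * _).
    rewrite eE /halfline_part !indicE zE /wD mem_halfline; case: (ltP 0 t) => t0.
      by rewrite !mul1r.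
    by rewrite mul0r mulr0 conjc0 mulr0 mul0r.
  rewrite mul0r /transform (_ : (fun _ => _) = fun=> 0) ?cint0 //.
  by apply/funext => t; rewrite eE indicE (negbTE zE) mul0r conjc0 mulr0 mul0r.
have hgram z : (\int[muE']_z' (cmod (gram lam e wD z z'))%:E <= C%:E)%E.
  case: (boolP (z \in E)) => zE; last first.
    under eq_integral do rewrite gramE indicE (negbTE zE) mul0r cmod0.
    by rewrite integral0 lee_fin ltW.
  rewrite integral_mfrestr; last first.
    move=> z' z'E; have E0 : \1_E z' = 0 :> R by rewrite indicE memNset.
    by rewrite gramE E0 mul0r mulr0 cmod0.
  under eq_integral => z' z'E do rewrite gramE !indicE zE z'E !mul1r.
  have zE' : Cplus z by apply: lt_le_trans delta0 (Edelta (set_mem zE)).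
  apply: le_trans (hC zE'); apply: ge0_subset_integral => //.
  - exact: measurable_Cplus.
  - apply/measurable_EFinP; apply: measurable_funTS; apply: measurable_cmod.
    exact: cmeasurable_kernel.
  - by move=> z' _; rewrite lee_fin cmod_ge0.
  - by move=> z' /Edelta; exact: lt_le_trans.
have := transform_sqr_le me eb mb mwD wD0 ibv mtf Noo C0 hgram.
rewrite -/N NE; apply: le_trans.
rewrite integral_mfrestr; last first.
  by move=> z zE; rewrite transformE indicE memNset // mul0r cmod0 expr0n.
rewrite le_eqVlt; apply/orP; left; apply/eqP.
by apply: eq_integral => z zE; rewrite transformE indicE zE mul1r -LaplaceE.
Qed.
End OnSet.

(** The degenerate case w = +oo almost everywhere. *)
Definition null_inverse := ae_eq lam D (fun t => fine (w t)^-1%E) (cst 0).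

Let v0 t : 0 < t -> 0 <= v t.
Proof. by move=> t0; rewrite fine_ge0 // inve_ge0 ltW // w0. Qed.

Let Dpos (t : R) : D t = (0 < t) :> Prop.
Proof. by rewrite /= in_itv /= andbT. Qed.

Lemma null_inverseP s : 0 < s ->
  \int[lam]_(t in D) (expR (- (s * t)) * v t) = 0 -> null_inverse.
Proof.
move=> s0 I0; have mD := @measurable_halfline R.
have ev0 t : D t -> 0 <= expR (- (s * t)) * v t.
  by rewrite Dpos => t0; rewrite mulr_ge0 ?expR_ge0 ?v0.
have H : (\int[lam]_(t in D) `|(expR (- (s * t)) * v t)%:E| = 0)%E.
  under eq_integral => t /set_mem tD do rewrite gee0_abs ?lee_fin ?ev0 //.
  rewrite -[LHS]fineK; last exact: integrable_fin_num (ive s0).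
  by rewrite -[fine _]/(\int[lam]_(t in D) (expR (- (s * t)) * v t)) I0.
have mf := measurable_int _ (ive s0).
have := (ae_eq_integral_abs lam mD mf).1 H.
apply: filterS => t /= h tD; have /eqP := h tD.
by rewrite eqe mulf_eq0 gt_eqF ?expR_gt0 //= => /eqP.
Qed.

(** |f|^2 w is integrable, hence finite almost everywhere; where w = +oo this
    forces f = 0. *)
Lemma null_inverse_Laplace f z : null_inverse -> L2 w f -> Laplace f z = 0.
Proof.
move=> nv fL2; have mD := @measurable_halfline R.
have mf := L2_cmeasurable fL2.
have ifw : lam.-integrable D (fun t => ((cmod (f t)) ^+ 2)%:E * w t)%E.
  apply/integrableP; split.
    apply: emeasurable_funM => //; apply/measurable_EFinP.
    apply: measurable_funX.
    apply: (@eq_measurable_fun _ _ _ _ _ (fun t => cmod (halfline_part f t))).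
      by move=> t tD; rewrite /halfline_part indicE tD mul1r.
    by apply: measurable_funTS; exact: measurable_cmod.
  under eq_integral => t /set_mem tD.
    rewrite gee0_abs; last by rewrite mule_ge0 ?lee_fin ?sqr_ge0 // ltW // w0 // -Dpos.
    over.
  exact: L2_lty.
have f0 : {ae lam, forall t, halfline_part f t = 0}.
  have := integrable_ae mD ifw; apply: filterS2 nv => t v0t fint.
  rewrite /halfline_part; have [tD|tD] := boolP (t \in D); last first.
    by rewrite indicE (negbTE tD) mul0r.
  have {}tD := set_mem tD.
  have wy : w t = +oo%E.
    have : (0 < w t)%E by rewrite w0 // -Dpos.
    have := v0t tD; case: (w t) => [r||] //= r0 rp.
    move: r0; rewrite fine_invr => /eqP; rewrite invr_eq0 => /eqP r0.
    by move: rp; rewrite r0 ltxx.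
  have := fint tD; rewrite wy; have [/eqP|fn0] := eqVneq (cmod (f t) ^+ 2) 0.
    by rewrite sqrf_eq0 => /eqP /ComplexField.Normc.eq0_normc -> _; rewrite mulr0.
  by rewrite gt0_muley // lte_fin lt_neqAle eq_sym fn0 sqr_ge0.
rewrite LaplaceE.
have mg : cmeasurable (fun t => halfline_part f t * laplace_kernel (z, t)).
  apply: cmeasurableM => //.
  exact: (cmeasurable_comp cmeasurable_laplace_kernel (pair1_measurable z)).
have Z (p : R[i] -> R) : p 0 = 0 ->
    measurable_fun setT (fun t => p (halfline_part f t * laplace_kernel (z, t))) ->
    \int[lam]_t p (halfline_part f t * laplace_kernel (z, t)) = 0.
  move=> p0 mp; rewrite /Rintegral (ae_eq_integral (cst 0%E)) ?integral0 //.
    exact/measurable_EFinP.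
  by apply: filterS f0 => t /= -> _; rewrite mul0r p0.
by case: mg => mr mi; rewrite /transform /cint !Z.
Qed.

(** The real part of k_(1 + i b)(x + i y) is
    int exp (- (1 + x) t) cos (t (b - y)) v(t) dt, which is continuous in b and
    positive at b = y.  Hence a rational b close to y will do, and a single
    rational parameter suffices to reach all zeta. *)
Lemma kernel_neq0 (zeta : borelC R) : ~ null_inverse -> Cplus zeta ->
  exists q : rat, A2kernel w (Complex 1 (ratr q)) zeta != 0.
Proof.
move=> nnv zp; have mD := @measurable_halfline R.
set x := complex.Re zeta; set y := complex.Im zeta.
have s0 : 0 < 1 + x by rewrite addr_gt0.
pose h (bt t : R) := expR (- ((1 + x) * t)) * v t * cos (t * bt).
pose F bt := \int[lam]_(t in D) h bt t.
have hle bt t : D t -> `|h bt t| <= expR (- ((1 + x) * t)) * v t.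
  rewrite Dpos => t0; rewrite normrM ger0_norm ?mulr_ge0 ?expR_ge0 ?v0 //.
  by rewrite ler_piMr ?mulr_ge0 ?expR_ge0 ?v0 // cos_max.
have ih bt : lam.-integrable D (EFin \o h bt).
  apply: le_integrable (ive s0) => //.
    apply/measurable_EFinP; apply: measurable_funM.
      by apply/measurable_EFinP; exact: measurable_int (ive s0).
    apply: measurable_funTS; apply: (measurableT_comp (continuous_measurable_fun _)).
      exact: continuous_cos.
    exact: measurable_funM.
  move=> t tD /=; rewrite lee_fin (le_trans (hle bt t tD)) //.
  exact: ler_norm.
have F0 : 0 < F 0.
  rewrite lt_neqAle eq_sym; apply/andP; split.
    apply/eqP => F00; apply: nnv; apply: (null_inverseP s0).
    rewrite -[RHS]F00; apply: eq_Rintegral => t _.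
    by rewrite /h mulr0 cos0 mulr1.
  apply: Rintegral_ge0 => t tD; rewrite /h mulr0 cos0 mulr1.
  by move: tD; rewrite Dpos => t0; rewrite mulr_ge0 ?expR_ge0 ?v0.
have cF : {for 0, continuous F}.
  have I0 : (0 : R) \in (`]-1, 1[%classic : set R).
    by rewrite inE /= in_itv /= ltrN10 ltr01.
  apply: (continuity_under_integral mD _ _ (ive s0) _ I0) => //.
  - by apply: aeW => t _ bt _; rewrite /h; apply: cvgM; [exact: cvg_cst|
      apply: continuous_comp; [exact: mulrl_continuous|exact: continuous_cos]].
  - by move=> bt _; apply: aeW => t; exact: hle.
have [r r0 Fr] : exists2 r, 0 < r & forall bt, `|bt| < r -> 0 < F bt.
  have /nbhs_ballP[r /= r0 Hr] : \forall bt \near (0 : R), 0 < F bt.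
    have cF0 : F bt @[bt --> (0 : R)] --> F 0 by exact: cF.
    by apply: (cvgr_gt (F 0) cF0); exact: F0.
  by exists r => // bt btr; apply: Hr; rewrite /ball /= sub0r normrN.
have [q qy] : exists q : rat, `|ratr q - y| < r.
  have yr : y - r < y + r by rewrite ltrD2l gt0_cp.
  have [q] := rat_in_itvoo yr; rewrite in_itv /= => qI; exists q.
  by rewrite ltr_norml; case/andP: qI => q1 q2; apply/andP; split; lra.
exists q; apply/eqP => k0.
have kE : complex.Re (A2kernel w (Complex 1 (ratr q)) zeta) = F (ratr q - y).
  transitivity (\int[lam]_(t in D) complex.Re
      (cexp (- (t%:C%C * (conjc (Complex 1 (ratr q)) + zeta))) * (v t)%:C%C)) => //.
  apply: eq_Rintegral => t _.
  rewrite cReM mulr0 subr0.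
  rewrite (_ : complex.Re (cexp _) = expR (complex.Re (- (t%:C%C * (conjc (Complex 1 (ratr q)) + zeta)))) *
    cos (complex.Im (- (t%:C%C * (conjc (Complex 1 (ratr q)) + zeta))))) //.
  rewrite Re_expo Im_expo /h /x /y; case: zeta {zp x y s0 h F hle ih F0 cF Fr qy k0} => a b /=.
  rewrite mulrAC; congr (expR _ * _ * cos _); first by ring.
  by ring.
by have := Fr _ qy; rewrite -kE k0 ltxx.
Qed.

Section Criterion.
Variables (mu : {measure set (borelC R) -> \bar R}) (C : R).
Hypothesis C0 : 0 < C.
Hypothesis hC : forall z, @Cplus R z ->
  (\int[mu]_(zeta in @Cplus R) (cmod (A2kernel w z zeta))%:E <= C%:E)%E.

Let mk z : measurable_fun setT (fun zeta => cmod (A2kernel w z zeta)).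
Proof. exact: measurable_cmod (cmeasurable_kernel z). Qed.

(** The sets U (q, n) where |k_(1 + i q)| >= 1 / (n + 1) have finite mass by Markov's
    inequality, and by [kernel_neq0] they cover the half-plane. *)
Lemma sigma_finite_Cplus : ~ null_inverse -> sigma_finite (@Cplus R) mu.
Proof.
move=> nnv.
pose U (p : rat * nat) : set (borelC R) := @Cplus R `&`
  [set zeta | p.2.+1%:R^-1 <= cmod (A2kernel w (Complex 1 (ratr p.1)) zeta)].
have mU p : measurable (U p).
  apply: measurableI; first exact: measurable_Cplus.
  rewrite [X in measurable X](_ : _ = setT `&`
    (fun zeta => cmod (A2kernel w (Complex 1 (ratr p.1)) zeta)) @^-1` `[p.2.+1%:R^-1, +oo[%classic).
    exact: mk.
  by rewrite setTI; apply/seteqP; split => z /=; rewrite in_itv /= andbT.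
have muU p : (mu (U p) < +oo)%E.
  have n0 : 0 < p.2.+1%:R^-1 :> R by rewrite invr_gt0.
  have zp : Cplus (Complex 1 (ratr p.1) : borelC R) by rewrite /Cplus /=.
  have H : ((p.2.+1%:R^-1)%:E * mu (U p) <= C%:E)%E.
    rewrite -integral_cst //; apply: le_trans (hC zp).
    apply: (@le_trans _ _ (\int[mu]_(zeta in U p)
        (cmod (A2kernel w (Complex 1 (ratr p.1)) zeta))%:E)%E).
      apply: ge0_le_integral => //.
      - by move=> x _; rewrite lee_fin ltW.
      - by apply/measurable_EFinP; apply: measurable_funTS.
      - by move=> x [_]; rewrite lee_fin.
    apply: ge0_subset_integral => //.
    - exact: measurable_Cplus.
    - by apply/measurable_EFinP; apply: measurable_funTS.
    - by move=> x _; rewrite lee_fin cmod_ge0.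
    - exact: subIsetl.
  rewrite ltey; apply/eqP => muy; move: H; rewrite muy gt0_muley // leye_eq //.
exists (fun k => if unpickle k is Some p then U p else set0); last first.
  by move=> k; case: unpickle => [p|]; rewrite ?measure0.
apply/seteqP; split => [z zp|z [k _]]; last by case: unpickle => [p []|].
have [q kq] := kernel_neq0 nnv zp.
have c0 : 0 < cmod (A2kernel w (Complex 1 (ratr q)) z).
  rewrite lt_neqAle cmod_ge0 andbT eq_sym.
  by apply: contra kq => /eqP /ComplexField.Normc.eq0_normc /eqP.
have [n hn] : exists n : nat, n.+1%:R^-1 <= cmod (A2kernel w (Complex 1 (ratr q)) z).
  by have [n] := ltr_add_invr c0; rewrite add0r => /ltW; exists n.
have [k kE] : exists k, unpickle k = Some (q, n).
  by exists (pickle (q, n)); exact: pickleK.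
by exists k; [exact: I | rewrite kE].
Qed.

(** Monotone convergence along sets of finite mass contained in the half-planes
    Re z >= 1 / (n + 1). *)
Lemma Laplace_sqr_le_Cplus f : L2 w f ->
  (\int[mu]_(z in @Cplus R) ((cmod (Laplace f z)) ^+ 2)%:E <=
   C%:E * \int[lam]_(t in D) (((cmod (f t)) ^+ 2)%:E * w t))%E.
Proof.
move=> fL2; have [nv|nnv] := pselect null_inverse.
  under eq_integral do rewrite (null_inverse_Laplace _ nv fL2) cmod0 expr0n.
  rewrite integral0; apply: mule_ge0; first by rewrite lee_fin ltW.
  apply: integral_ge0 => t; rewrite /= in_itv /= andbT => t0.
  by rewrite mule_ge0 ?lee_fin ?sqr_ge0 // ltW // w0.
have /sigma_finiteP[F [FE ndF mF]] := sigma_finite_Cplus nnv.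
pose E n := F n `&` [set z : borelC R | n.+1%:R^-1 <= complex.Re z].
have mE n : measurable (E n).
  by apply: measurableI; [case: (mF n)|exact: measurable_ReGe].
have muE n : (mu (E n) < +oo)%E.
  have [mFn] := mF n; apply: le_lt_trans; apply: le_measure; rewrite ?inE //.
  exact: subIsetl.
have ndE : nondecreasing_seq E.
  move=> i j ij; rewrite subsetEset => z [Fz zi]; split.
    by have := ndF _ _ ij; rewrite subsetEset; exact.
  apply: le_trans zi; rewrite lef_pV2 ?posrE // ler_nat ltnS //.
have EE : \bigcup_n E n = @Cplus R.
  apply/seteqP; split => [z [n _ [Fz _]]|z zp]; first by rewrite FE; exists n.
  have [n] := ltr_add_invr zp; rewrite add0r => /ltW nz.
  have : (\bigcup_i F i) z by rewrite -FE.
  move=> [i _ Fz]; exists (maxn i n) => //; split.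
    have := ndF _ _ (leq_maxl i n); rewrite subsetEset; exact.
  by apply: le_trans nz; rewrite lef_pV2 ?posrE // ler_nat ltnS leq_maxr.
rewrite -EE.
have mL : measurable_fun setT (fun z => ((cmod (Laplace f z)) ^+ 2)%:E).
  apply/measurable_EFinP; apply: measurable_funX; apply: measurable_cmod.
  exact: cmeasurable_Laplace (L2_cmeasurable fL2).
have H := @ge0_nondecreasing_set_cvg_integral _ _ _ E (fun z => ((cmod (Laplace f z)) ^+ 2)%:E) mu ndE mE.
have {}H := H (fun i => measurable_funTS mL).
have {}H := H (fun i z _ => etrans (lee_fin _ _) (sqr_ge0 _)).
rewrite -(cvg_lim _ H) //; apply: lime_le; first exact: (cvgP _ H).
apply: nearW => n.
have n0 : 0 < n.+1%:R^-1 :> R by rewrite invr_gt0.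
by apply: (Laplace_sqr_le C0 hC (mE n) n0 (muE n)) => // z [].
Qed.

End Criterion.
End Weighted.

(** The bound holds for every f that represents h, hence for the infimum of their
    norms; taking square roots first turns it into a lower bound of the norms. *)
Theorem carleson_of_kernel (R : realType) (w : R -> \bar R)
    (mu : {measure set (borelC R) -> \bar R}) :
  measurable_fun (`]0, +oo[%classic : set (measurableTypeR R)) w ->
  (forall t, 0 < t -> (0 < w t)%E) ->
  (forall s, 0 < s -> (@lebesgue_measure R).-integrable `]0, +oo[%classic
     (EFin \o (fun t => expR (- (s * t)) * fine (w t)^-1%E))) ->
  (ereal_sup [set \int[mu]_(zeta in @Cplus R) (cmod (A2kernel w z zeta))%:E |
     z in @Cplus R] < +oo)%E ->
  Carleson (A2 w) (A2norm w) mu.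
Proof.
move=> mw w0 ive supoo.
set s := ereal_sup _ in supoo.
have s0 : (0 <= s)%E.
  apply: le_ereal_sup_tmp; eexists; first by exists (1 : R[i]) => //; rewrite /Cplus /= ltr01.
  by apply: integral_ge0 => z _; rewrite lee_fin cmod_ge0.
(* The supremum may be 0, but a Carleson constant must be positive. *)
pose C := fine s + 1.
have C0 : 0 < C by rewrite ltr_wpDl // fine_ge0.
have hC z : @Cplus R z ->
    (\int[mu]_(zeta in @Cplus R) (cmod (A2kernel w z zeta))%:E <= C%:E)%E.
  move=> zp; apply: (@le_trans _ _ s); first by apply: ereal_sup_ubound; exists z.
  by rewrite -(fineK (x := s)) ?ge0_fin_numE // lee_fin lerDl.
exists C => // h _.
set I := (\int[mu]_(z in _) _)%E.
have I0 : (0 <= I)%E by apply: integral_ge0 => z _; rewrite lee_fin sqr_ge0.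
have CI0 : (0 <= (C^-1)%:E * I)%E by rewrite mule_ge0 // lee_fin invr_ge0 ltW.
have cN : (sqrte ((C^-1)%:E * I) <= A2norm w h)%E.
  apply: le_ereal_inf_tmp => _ [f [fL2 hf] <-].
  rewrite -poweR12_sqrt // /L2norm.
  have := Laplace_sqr_le_Cplus mw w0 ive C0 hC fL2.
  rewrite (_ : integral mu _ _ = I); last first.
    by apply: eq_integral => z /set_mem zp; rewrite hf.
  set J := integral _ _ _ => IJ.
  have J0 : (0 <= J)%E.
    apply: integral_ge0 => t; rewrite /= in_itv /= andbT => t0.
    by rewrite mule_ge0 ?lee_fin ?sqr_ge0 // ltW // w0.
  apply: gt0_ler_poweR; rewrite ?invr_ge0 ?in_itv /= ?leey ?andbT //.
  by rewrite muleC lee_pdivrMr // muleC.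
have -> : I = (C%:E * (sqrte ((C^-1)%:E * I)) ^+ 2)%E.
  by rewrite sqr_sqrte // muleA -EFinM divff ?gt_eqF // mul1e.
rewrite lee_pmul2l // ?lte_fin // !expe2.
by apply: lee_pmul => //; exact: sqrte_ge0.
Qed.

(** * The weights of doubling measures *)
Section Weights.
Context {R : realType}.
Notation Y := (measurableTypeR R).
Notation lam := (@lebesgue_measure R).
Notation D := (`]0, +oo[%classic : set Y).
Implicit Type nu : {measure set Y -> \bar R}.

(** If nu [0, r) = 0, the finiteness of nu [0, 2 s) / nu [0, s) gives
    nu [0, 2^n r) = 0 for all n, so nu would vanish on [0, +oo). *)
Lemma Delta2_gt0 nu (r : R) : Delta2 nu -> 0 < r -> (0 < nu `[0%R, r[%classic)%E.
Proof.
move=> [nu0 _ _ supoo] r0; rewrite lt0e measure_ge0 andbT; apply/negP => /eqP nur.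
have dbl s : 0 < s -> nu `[0%R, s[%classic = 0%E -> nu `[0%R, (2 * s)%R[%classic = 0%E.
  move=> s0 nus; apply: contrapT => /eqP nn.
  have p : (0 < nu `[0%R, (2 * s)%R[%classic)%E by rewrite lt0e nn measure_ge0.
  move: supoo; rewrite ltNge => /negP; apply.
  apply: le_ereal_sup_tmp; exists +oo%E => //.
  by exists s => //; rewrite nus inve0 gt0_muley.
have pw n : nu `[0%R, (2 ^+ n * r)%R[%classic = 0%E.
  elim: n => [|n IH]; first by rewrite expr0 mul1r.
  by rewrite exprS -mulrA; apply: dbl => //; rewrite mulr_gt0 // exprn_gt0.
move/eqP: nu0; apply.
have cover : (`[0%R, +oo[%classic : set Y) = \bigcup_n `[0%R, (2 ^+ n * r)%R[%classic.
  apply/seteqP; split => [x /=|x [n _]] /=; rewrite !in_itv /= andbT; last by case/andP.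
  move=> x0; have [n nx] : exists n : nat, x < 2 ^+ n * r.
    exists (Num.truncn (x / r)).+1; rewrite -ltr_pdivrMr //.
    apply: lt_le_trans (truncnS_gt _) _.
    by rewrite -natrX ler_nat ltnW // ltn_expl.
  by exists n => //=; rewrite in_itv /= x0.
have mF n : measurable (`[0%R, (2 ^+ n * r)%R[%classic : set Y) by exact: measurable_itv.
have ndF : nondecreasing_seq (fun n => `[0%R, (2 ^+ n * r)%R[%classic : set Y).
  move=> i j ij; rewrite subsetEset; apply: subset_itvl; rewrite bnd_simp.
  by rewrite ler_pM2r // ler_weXn2l // ler1n.
have mU : measurable (\bigcup_n (`[0%R, (2 ^+ n * r)%R[%classic : set Y)).
  by rewrite -cover; exact: measurable_itv.
have := nondecreasing_cvg_mu (mu := nu) mF mU ndF.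
rewrite (_ : _ \o _ = cst 0%E); last by apply/funext => n /=; exact: pw.
by rewrite cover => /cvg_lim <- //; rewrite lim_cst.
Qed.

Definition laplace_mass nu (t : R) : \bar R :=
  (\int[nu]_(r in `[0%R, +oo[) (expR (- (2 * r * t)))%:E)%E.

Let mexp nu (A : set Y) (t : R) :
  measurable_fun A (fun r : Y => (expR (- (2 * r * t)))%:E).
Proof.
apply/measurable_EFinP; apply: measurableT_comp => //.
apply: measurable_funTS; apply: measurable_funN.
by apply: measurable_funM => //; exact: measurable_funM.
Qed.

Lemma laplace_mass_ge0 nu t : (0 <= laplace_mass nu t)%E.
Proof. by apply: integral_ge0 => r _; rewrite lee_fin expR_ge0. Qed.

Lemma laplace_mass_nonincreasing nu s t : s <= t -> (laplace_mass nu t <= laplace_mass nu s)%E.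
Proof.
move=> st; apply: ge0_le_integral => //.
- exact: mexp.
- exact: mexp.
- move=> r; rewrite /= in_itv /= andbT => r0.
  by rewrite lee_fin ler_expR lerN2 ler_wpM2l // mulr_ge0.
Qed.

(** The superlevel sets are intervals.  This yields the measurability in t of the
    integrals of exp (- 2 r t) against any measure, sigma-finite or not. *)
Lemma nonincreasing_emeasurable (F : R -> \bar R) :
  (forall s t, s <= t -> (F t <= F s)%E) -> measurable_fun setT F.
Proof.
move=> Fni.
apply: (measurability _ (ErealGenOInfty.measurableE R)) => _ [_ [r ->] <-].
rewrite setTI; apply: is_interval_measurable => s t /=.
rewrite !in_itv /= !andbT => fs ft u /andP[su ut].
by rewrite in_itv /= andbT (lt_le_trans ft) // Fni.
Qed.

Lemma measurable_laplace_mass nu : measurable_fun setT (laplace_mass nu).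
Proof. by apply: nonincreasing_emeasurable => s t; exact: laplace_mass_nonincreasing. Qed.

Lemma weightE nu n t :
  weight nu n t = ((2 * pi * t ^+ n.*2)%:E * laplace_mass nu t)%E.
Proof. by []. Qed.

Lemma weight_ge0 nu n t : (0 <= weight nu n t)%E.
Proof.
rewrite mule_ge0 ?laplace_mass_ge0 // lee_fin mulr_ge0 ?mulr_ge0 ?pi_ge0 //.
by rewrite -mul2n exprM exprn_ge0 // sqr_ge0.
Qed.

Lemma measurable_weight nu n : measurable_fun setT (weight nu n).
Proof.
apply: emeasurable_funM; last exact: measurable_laplace_mass.
by apply/measurable_EFinP; apply: measurable_funM => //; exact: measurable_funX.
Qed.

Lemma laplace_mass_ge nu (r t : R) : 0 <= t ->
  ((expR (- (2 * r * t)))%:E * nu `[0%R, r[%classic <= laplace_mass nu t)%E.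
Proof.
move=> t0; rewrite -integral_cst //.
apply: (@le_trans _ _ (\int[nu]_(x in `[0%R, r[) (expR (- (2 * x * t)))%:E)%E).
  apply: ge0_le_integral => //.
  - by move=> x _; rewrite lee_fin expR_ge0.
  - exact: mexp.
  - move=> x; rewrite /= in_itv /= => /andP[_ xr].
    by rewrite lee_fin ler_expR lerN2 ler_wpM2r // ler_wpM2l // ltW.
apply: ge0_subset_integral => //.
- exact: mexp.
- by move=> x /=; rewrite !in_itv /= andbT => /andP[].
Qed.

Section Sum.
Variables (m : option nat) (nu : nat -> {measure set Y -> \bar R}).
Hypothesis hnu : forall n, upto m n -> Delta2 (nu n).

Lemma measurable_weight_sum : measurable_fun D (weight_sum m nu).
Proof.
apply: measurable_funTS; apply: (@ge0_emeasurable_sum _ _ _ _ (fun n => weight (nu n) n) (upto m)).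
  by move=> k x _ _; exact: weight_ge0.
by move=> k _; exact: measurable_weight.
Qed.

Lemma weight_sum_ge_weight0 t : (weight (nu 0%N) 0 t <= weight_sum m nu t)%E.
Proof.
have := @nneseries_lim_ge R (fun n => weight (nu n) n t) (upto m) 0 1 (fun n _ _ => weight_ge0 _ _ _).
by rewrite big_mkcond big_nat1; case: (m).
Qed.

Lemma weight_sum_lower (r : R) : 0 < r -> exists2 c : R, 0 < c &
  forall t, 0 < t -> ((c * expR (- (2 * r * t)))%:E <= weight_sum m nu t)%E.
Proof.
move=> r0.
have D0 : Delta2 (nu 0%N) by apply: hnu; case: (m).
have nup := Delta2_gt0 D0 r0.
have [c c0 cn] : exists2 c : R, 0 < c & (c%:E <= nu 0%N `[0%R, r[%classic)%E.
  case: (nu 0%N `[0%R, r[%classic) nup => [a||] // a0; first by exists a.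
  by exists 1 => //; rewrite leey.
exists (2 * pi * c); first by rewrite !mulr_gt0 ?pi_gt0.
move=> t t0; apply: le_trans (weight_sum_ge_weight0 t).
rewrite weightE expr0 mulr1 -mulrA EFinM lee_pmul2l ?lte_fin ?mulr_gt0 ?pi_gt0 //.
apply: le_trans (laplace_mass_ge (nu 0%N) r (ltW t0)).
by rewrite mulrC EFinM lee_pmul2l // lte_fin expR_gt0.
Qed.

Lemma weight_sum_gt0 t : 0 < t -> (0 < weight_sum m nu t)%E.
Proof.
move=> t0; have [c c0 H] := weight_sum_lower ltr01.
by apply: lt_le_trans (H _ t0); rewrite lte_fin mulr_gt0 // expR_gt0.
Qed.

Lemma integrable_expR (a : R) : 0 < a ->
  lam.-integrable D (EFin \o (fun t => expR (- (a * t)))).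
Proof.
move=> a0.
have ip : lam.-integrable D (EFin \o exponential_pdf a).
  apply: (@integrableS _ _ _ _ setT) => //.
  have mp : measurable_fun setT (EFin \o exponential_pdf a).
    by apply/measurable_EFinP; exact: measurable_exponential_pdf.
  apply/integrableP; split => //.
  under eq_integral do rewrite gee0_abs ?lee_fin ?exponential_pdf_ge0 ?ltW //.
  by rewrite integral_exponential_pdf // ltry.
have := integrableZl (measurable_halfline (R := R)) a^-1 ip.
apply: eq_integrable => [|t]; first exact: measurable_halfline.
rewrite mem_halfline => t0 /=; rewrite exponential_pdfE ?ltW // -EFinM mulKf ?gt_eqF //.
by rewrite mulNr.
Qed.

(** By [weight_sum_lower] with r = s / 4 the inverse weight is at most a multiple
    of exp (s t / 2), which leaves exp (- s t / 2). *)
Lemma integrable_weight_inverse s : 0 < s ->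
  lam.-integrable D (EFin \o (fun t => expR (- (s * t)) * fine (weight_sum m nu t)^-1%E)).
Proof.
move=> s0; have mD := @measurable_halfline R.
have s4 : 0 < s / 4 by rewrite divr_gt0.
have [c c0 H] := weight_sum_lower s4.
have s2 : 0 < s / 2 by rewrite divr_gt0.
apply: le_integrable (integrableZl mD c^-1 (integrable_expR s2)) => //.
  apply/measurable_EFinP; apply: measurable_funM.
    apply: measurable_funTS; apply: measurableT_comp => //.
    by apply: measurable_funN; exact: measurable_funM.
  apply: measurable_fine_inve measurable_weight_sum => y.
  by rewrite /= in_itv /= andbT; exact: weight_sum_gt0.
move=> t; rewrite /= in_itv /= andbT => t0.
have w0 := weight_sum_gt0 t0.
have c1 : 0 < c^-1 by rewrite invr_gt0.
rewrite lee_fin !ger0_norm ?mulr_ge0 ?expR_ge0 ?(ltW c1) ?fine_ge0 ?inve_ge0 ?(ltW w0) //.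
rewrite (_ : expR (- (s * t)) = expR (- (s / 2 * t)) * expR (- (2 * (s / 4) * t))); last first.
  by rewrite -expRD; congr expR; field.
rewrite [leRHS]mulrC -mulrA ler_wpM2l ?expR_ge0 //.
have := H _ t0; case: (weight_sum m nu t) w0 => [x||] // x0; last first.
  by move=> _; rewrite invey /= mulr0 ltW.
rewrite lee_fin fine_invr => cx.
by rewrite ler_pdivrMr // ler_pdivlMl.
Qed.

End Sum.
End Weights.

Theorem proposition1 (R : realType) (m : option nat)
  (nu : nat -> {measure set (measurableTypeR R) -> \bar R})
  (hnu : forall n : nat, upto m n -> Delta2 (nu n))
  (mu : {measure set (borelC R) -> \bar R})
  (hmu : (ereal_sup
            [set \int[mu]_(zeta in @Cplus R)
                   (cmod (A2kernel (weight_sum m nu) z zeta))%:E |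
             z in @Cplus R] < +oo)%E) :
  Carleson (A2 (weight_sum m nu)) (A2norm (weight_sum m nu)) mu.
Proof.
apply: carleson_of_kernel hmu.
- exact: measurable_weight_sum.
- exact: weight_sum_gt0.
- exact: integrable_weight_inverse.
Qed.
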